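(* Let $X_1,\ldots,X_n$ be independent (not necessarily identically distributed) random variables with $\mathbb{E} X_i=0$ and $\mathbb{E} X_i^2=1$ for each $i$, and write $X=(X_1,\ldots,X_n)$. Let $\theta_1,\ldots,\theta_k$ be fixed vectors in $\mathbb{R}^n$, with $\theta_i=(\theta_i^1,\ldots,\theta_i^n)$, such that $\langle\theta_i,\theta_j\rangle=\delta_{ij}$ for all $i,j$. Define a random vector $S_n=(S_n^1,\ldots,S_n^k)\in\mathbb{R}^k$ by $$S_n^i=\langle\theta_i,X\rangle=\sum_{r=1}^n\theta_i^rX_r.$$ Then for every $g\in C_c^2(\mathbb{R}^k)$, $$\big|\mathbb{E} g(S_n)-\mathbb{E} g(Z)\big|\le\frac{\sqrt{k}}{2}\,\||\nabla g|\|_\infty\sqrt{\max_{1\le i\le n}\mathbb{E} X_i^4-1}\left(\sum_{i=1}^k\|\theta_i\|_4^2\right)+\frac{4}{3}k^2|g|_2\left(\max_{1\le j\le n}\mathbb{E}|X_j|^3\right)\left(\sum_{i=1}^k\|\theta_i\|_3^3\right),$$ where $Z$ is distributed as a standard normal random vector in $\mathbb{R}^k$.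
   Context: $C^2_c(\mathbb{R}^k)$ is the space of compactly supported, real-valued functions on $\mathbb{R}^k$ with two continuous derivatives. $\||\nabla g|\|_\infty=\sup_x|\nabla g(x)|$ is the maximum (Euclidean) length of the gradient of $g$. $|g|_2=\max_{i,j}\sup_x\left|\frac{\partial^2 g}{\partial x_i\partial x_j}(x)\right|$. For $\theta\in\mathbb{R}^n$, $\|\theta\|_p=\left(\sum_{r=1}^n|\theta^r|^p\right)^{1/p}$, where superscripts $r$ on vectors denote coordinates. $\langle\cdot,\cdot\rangle$ is the standard inner product on $\mathbb{R}^n$ and $\delta_{ij}$ is the Kronecker delta. *)

(* Defs.v *)
From HB Require Import structures.
From mathcomp Require Export all_boot all_order all_algebra.
From mathcomp Require Export all_classical all_reals all_analysis.
Export Order.TTheory GRing.Theory Num.Theory.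
Export numFieldNormedType.Exports.

Set Implicit Arguments.
Unset Strict Implicit.
Unset Printing Implicit Defensive.

Local Open Scope classical_set_scope.
Local Open Scope ring_scope.

(* The norm that the library puts on ['rV[R]_n] is the max norm, hence the
   separate Euclidean and l^p norms below; the topologies coincide. *)
Definition dotv (R : realType) (n : nat) (u v : 'rV[R]_n) : R :=
  \sum_(r < n) u 0 r * v 0 r.

Definition enorm (R : realType) (n : nat) (u : 'rV[R]_n) : R :=
  Num.sqrt (dotv u u).

Definition lpnorm (R : realType) (n : nat) (p : R) (u : 'rV[R]_n) : R :=
  (\sum_(r < n) `|u 0 r| `^ p) `^ p^-1.

Definition orthonormal_family (R : realType) (n k : nat)
    (theta : 'I_k -> 'rV[R]_n) : Prop :=
  forall i j : 'I_k, dotv (theta i) (theta j) = (i == j)%:R.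

Definition partial (R : realType) (k : nat) (i : 'I_k) (g : 'rV[R]_k -> R) :
    'rV[R]_k -> R :=
  fun x => 'D_(delta_mx 0 i) g x.

Definition has_partial (R : realType) (k : nat) (i : 'I_k)
    (g : 'rV[R]_k -> R) : Prop :=
  forall x, derivable g x (delta_mx 0 i).

Definition gradient (R : realType) (k : nat) (g : 'rV[R]_k -> R)
    (x : 'rV[R]_k) : 'rV[R]_k :=
  \row_i partial i g x.

Definition C2 (R : realType) (k : nat) (g : 'rV[R]_k -> R) : Prop :=
  [/\ continuous g,
      forall i, has_partial i g /\ continuous (partial i g)
    & forall i j, has_partial i (partial j g) /\
                  continuous (partial i (partial j g))].

Definition C2c (R : realType) (k : nat) (g : 'rV[R]_k -> R) : Prop :=
  C2 g /\ compact (closure [set x | g x != 0]).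

(* Suprema and moments are extended reals: the third and fourth moments below
   are not assumed finite. *)
Definition grad_sup (R : realType) (k : nat) (g : 'rV[R]_k -> R) : \bar R :=
  ereal_sup (range (fun x => (enorm (gradient g x))%:E)).

(* Here and for the moments, the terms of the maximum are nonnegative, so that
   starting from [0] only fixes the value of an empty maximum. *)
Definition hess_sup (R : realType) (k : nat) (g : 'rV[R]_k -> R) : \bar R :=
  \big[maxe/0%E]_(i < k) \big[maxe/0%E]_(j < k)
    ereal_sup (range (fun x => `|partial i (partial j g) x|%:E)).

Definition mutually_independent (d : measure_display) (T : measurableType d)
    (R : realType) (P : probability T R) (I : finType)
    (X : I -> {RV P >-> R}) : Prop :=
  forall (J : {set I}) (A : I -> set R), (forall i, measurable (A i)) ->
    P (\bigcap_(i in [set` J]) X i @^-1` A i) =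
    (\prod_(i in J) P (X i @^-1` A i))%E.

Arguments mutually_independent {d T R} P {I} X.

Definition random_vector (d : measure_display) (T : measurableType d)
    (R : realType) (P : probability T R) (n : nat)
    (X : 'I_n -> {RV P >-> R}) : T -> 'rV[R]_n :=
  fun w => \row_i X i w.

Definition standard_normal (d : measure_display) (T : measurableType d)
    (R : realType) (P : probability T R) (k : nat)
    (Z : 'I_k -> {RV P >-> R}) : Prop :=
  mutually_independent P Z /\
  forall (i : 'I_k) (A : set R), measurable A ->
    distribution P (Z i) A = normal_prob 0 1 A.

Definition projections (d : measure_display) (T : measurableType d)
    (R : realType) (P : probability T R) (n k : nat)
    (theta : 'I_k -> 'rV[R]_n) (X : 'I_n -> {RV P >-> R}) : T -> 'rV[R]_k :=
  fun w => \row_i dotv (theta i) (random_vector X w).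

Definition max_moment4 (d : measure_display) (T : measurableType d)
    (R : realType) (P : probability T R) (n : nat)
    (X : 'I_n -> {RV P >-> R}) : \bar R :=
  \big[maxe/0%E]_(i < n) 'E_P[(fun w => X i w ^+ 4)%R]%E.

Definition max_abs_moment3 (d : measure_display) (T : measurableType d)
    (R : realType) (P : probability T R) (n : nat)
    (X : 'I_n -> {RV P >-> R}) : \bar R :=
  \big[maxe/0%E]_(j < n) 'E_P[(fun w => `|X j w| ^+ 3)%R]%E.

Arguments standard_normal {d T R} P {k} Z.
Arguments max_moment4 {d T R} P {n} X.
Arguments max_abs_moment3 {d T R} P {n} X.

(* Main.v *)
Require Import Defs.
From mathcomp Require Import ring lra measurable_realfun.

(** The difference is controlled by interpolating between the two vectors along the
    rotation [U s = sin s *: S + cos s *: Z], where [S] and [Z] are taken independent,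
    on the product of their sample spaces. Write [F s] for the expectation of [g (U s)],
    [a = sin s], [b = cos s], and [B] for the supremum of the second derivatives of [g].

    The derivative of [F] pairs the velocity [b S - a Z] with the gradient of [g] at
    [U s]. Integrating over [Z] first replaces each partial derivative of [g] by its
    Gaussian regularization [G j] at scale [b] ([smooth]). For the part in [Z], Gaussian
    integration by parts ([gaussian_ibp], obtained from the one-dimensional Stein identity
    by resampling one coordinate) produces the expectations of the smoothed second
    derivatives [H i j]. For the part in [S], a linear combination of the [X r], each
    expectation of [X r * G j (a *: S)] is expanded around the value of [S] without its
    [r]-th summand ([leave_one_out]): as [X r] is centred, has variance one and is
    independent of the rest, what comes out is [a] times a combination of the
    expectations of the [H i j], with an error of third order. By orthonormality of
    [theta] the two main contributions cancel exactly ([orthonormal_cancellation]), and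
    only the errors are left ([interpolation_derivative_le]).

    The errors are third-order although [g] has only two derivatives: integration by
    parts shows that [H i j] is Lipschitz with constant [B / b]
    ([smooth_partial_lipschitz], [smooth_taylor]). The singular factor [1 / b] is
    compensated by the factor [b] of the velocity, so that
    [|F' s| <= 3 / 2 * a ^ 2 * B * m * W] where [m] bounds the third absolute moments and
    [W] is the sum over [r] of the cubes of the l^1 norms of the columns of [theta].
    Integrating over [[0, pi / 2]] gives the constant [5 / 4] ([interpolation_bound]), and
    the power mean inequality bounds [W] by [k ^ 2] times the sum of the cubed l^3 norms.
    As [5 / 4 <= 4 / 3], the difference is at most the second term of the bound, and the
    first term is nonnegative. *)

Set Implicit Arguments.
Unset Strict Implicit.
Unset Printing Implicit Defensive.

Local Open Scope classical_set_scope.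
Local Open Scope ring_scope.

(** * Calculus along curves in row vectors *)

Lemma near_ord (T : Type) (k : nat) (F : set_system T) {FF : Filter F}
    (P : 'I_k -> T -> Prop) :
  (forall i, \forall x \near F, P i x) -> \forall x \near F, forall i, P i x.
Proof. exact: (@filter_forall _ 'I_k). Qed.

Lemma is_derive_mulr_cst (R : realType) (c t : R) : is_derive t 1 (fun s => s * c) c.
Proof.
have := is_deriveM (is_derive_id t (1 : R)) (is_derive_cst c t (1 : R)).
by rewrite /= scaler0 add0r -[_ *: _]/(_ * _) mulr1.
Qed.

Lemma is_derive_line (R : realType) (V : normedModType R) (g : V -> R) (z v : V) (t : R) :
  derivable g (t *: v + z) v ->
  is_derive t 1 (fun h => g (h *: v + z)) ('D_v g (t *: v + z)).
Proof.
have E : (fun h : R => h^-1 *: (((fun h => g (h *: v + z)) \o shift t) (h *: 1)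
    - g (t *: v + z)))
  = (fun h : R => h^-1 *: ((g \o shift (t *: v + z)) (h *: v) - g (t *: v + z))).
  by apply/funext => h /=; rewrite /shift /= !scaler1 scalerDl addrA.
by move=> dg; split; rewrite /derivable /derive E.
Qed.

(** Mean value inequality against a comparison function [p] whose slope may vary: this is
    what produces the factor one half in second-order expansions, and the total cost of
    the Gaussian interpolation at the end. *)
Lemma increment_le (R : realType) (f df p dp : R -> R) (a b : R) : a <= b ->
  (forall t : R, is_derive t 1 f (df t)) -> (forall t : R, is_derive t 1 p (dp t)) ->
  (forall t, t \in `]a, b[ -> `|df t| <= dp t) -> `|f b - f a| <= p b - p a.
Proof.
rewrite le_eqVlt => /predU1P[-> _ _ _|ab fd pd dfp].
  by rewrite !subrr normr0.
have ab0 : 0 <= b - a by rewrite subr_ge0 ltW.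
have cont (q dq : R -> R) : (forall t : R, is_derive t 1 q (dq t)) -> {within `[a, b], continuous q}.
  move=> qd; apply/continuous_subspaceT => t.
  by apply/differentiable_continuous/derivable1_diffP; case: (qd t).
have pfd t : is_derive t (1 : R) (p - f) (dp t - df t) by exact: is_deriveB.
have pfd' t : is_derive t (1 : R) (p + f) (dp t + df t) by exact: is_deriveD.
have [c cab E] := MVT ab (fun t _ => pfd t) (cont _ _ pfd).
have [c' cab' E'] := MVT ab (fun t _ => pfd' t) (cont _ _ pfd').
have := dfp c cab; have := dfp c' cab'.
rewrite !ler_norml => /andP[h1 _] /andP[_ h2].
have : 0 <= (p - f) b - (p - f) a by rewrite E mulr_ge0// subr_ge0.
have : 0 <= (p + f) b - (p + f) a by rewrite E' mulr_ge0//; lra.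
by rewrite !fctE => h3 h4; apply/andP; split; lra.
Qed.

Lemma is_derive_increment (R : realType) (f df : R -> R) (M h : R) :
  (forall t : R, is_derive t 1 f (df t)) ->
  (forall t, `|t| <= `|h| -> `|df t| <= M) -> `|f h - f 0| <= M * `|h|.
Proof.
move=> fd dM; have Md (t : R) : is_derive t 1 (fun s => s * M) M := is_derive_mulr_cst M t.
have [h0|h0] := leP 0 h.
  have := increment_le h0 fd Md; rewrite (ger0_norm h0) mul0r subr0 mulrC; apply.
  move=> t; rewrite in_itv/= => /andP[t0 th]; apply: dM.
  by rewrite !ger0_norm// ltW.
have := increment_le (ltW h0) fd Md; rewrite distrC (ltr0_norm h0) mul0r sub0r mulrN mulrC.
apply; move=> t; rewrite in_itv/= => /andP[t0 th]; apply: dM.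
by rewrite !ltr0_norm// lerN2 ltW.
Qed.

Definition C1 (R : realType) (k : nat) (g : 'rV[R]_k -> R) : Prop :=
  forall i, has_partial i g /\ continuous (partial i g).

Definition l1norm (R : realType) (k : nat) (u : 'rV[R]_k) : R :=
  \sum_(i < k) `|u 0 i|.

(** The corners of the path from [x] to [y] that changes one coordinate at a time. *)
Definition hybrid (R : realType) (k : nat) (x y : 'rV[R]_k) (m : nat) : 'rV[R]_k :=
  \row_i (if (i < m)%N then y 0 i else x 0 i).

Lemma hybridS (R : realType) (k : nat) (x y : 'rV[R]_k) (i : 'I_k) :
  hybrid x y i.+1 = (y 0 i - x 0 i) *: delta_mx 0 i + hybrid x y i.
Proof.
apply/rowP => j; rewrite !mxE ltnS leq_eqVlt eqxx/=.
have [/val_inj ->|ji] := eqVneq (val j) (val i).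
  by rewrite ltnn eqxx mulr1 subrK.
by rewrite (_ : (j == i) = false) ?mulr0 ?add0r//; apply: contra_neqF ji => /eqP ->.
Qed.

Lemma sub_telescope_hybrid (R : realType) (k : nat) (g : 'rV[R]_k -> R)
    (x y : 'rV[R]_k) :
  g y - g x = \sum_(i < k) (g (hybrid x y i.+1) - g (hybrid x y i)).
Proof.
rewrite -(big_mkord xpredT (fun i => g (hybrid x y i.+1) - g (hybrid x y i))).
rewrite telescope_sumr//; congr (g _ - g _); apply/rowP => i; rewrite !mxE//.
by rewrite ltn_ord.
Qed.

Lemma l1norm_ge0 (R : realType) (k : nat) (u : 'rV[R]_k) : 0 <= l1norm u.
Proof. by apply: sumr_ge0. Qed.

(** Mean value inequality along each leg of the coordinate path: every point met lies
    coordinatewise between [x] and [y], so bounds on partial derivatives suffice. *)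
Lemma partials_increment (R : realType) (k : nat) (g : 'rV[R]_k -> R)
    (x y : 'rV[R]_k) (L : 'rV[R]_k) (e : R) : C1 g ->
  (forall i (z : 'rV[R]_k), (forall j, `|z 0 j - x 0 j| <= `|y 0 j - x 0 j|) ->
     `|partial i g z - L 0 i| <= e) ->
  `|g y - g x - \sum_i (y 0 i - x 0 i) * L 0 i| <= e * l1norm (y - x).
Proof.
move=> gC ge; rewrite sub_telescope_hybrid -sumrB /l1norm mulr_sumr.
apply: le_trans (ler_norm_sum _ _ _) _; apply: ler_sum => i _.
rewrite hybridS !mxE; set z := hybrid x y i; set h := y 0 i - x 0 i.
pose f t := g (t *: delta_mx 0 i + z) - t * L 0 i.
have fd (t : R) : is_derive t 1 f (partial i g (t *: delta_mx 0 i + z) - L 0 i).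
  have d1 := @is_derive_line R _ g z (delta_mx 0 i) t ((gC i).1 _).
  apply: is_deriveB.
  exact: is_derive_mulr_cst.
have -> : g (h *: delta_mx 0 i + z) - g z - h * L 0 i = f h - f 0.
  by rewrite /f scale0r mul0r add0r subr0 addrAC.
apply: is_derive_increment fd _ => t th; apply: ge => j.
rewrite !mxE /=; have [->|ji] := eqVneq j i.
  by rewrite ltnn mulr1 addrK.
by rewrite mulr0 add0r; case: ifP => _; rewrite ?subrr ?normr0.
Qed.

Lemma lipschitz_l1norm (R : realType) (k : nat) (g : 'rV[R]_k -> R) (B : R) :
  C1 g -> (forall i x, `|partial i g x| <= B) ->
  forall x y, `|g x - g y| <= B * l1norm (x - y).
Proof.
move=> gC gB x y; have := @partials_increment R k g y x 0 B gC.
rewrite big1 ?subr0; last by move=> i _; rewrite mxE mulr0.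
by apply => i z _; rewrite mxE subr0.
Qed.

Lemma partial_near_constant (R : realType) (k : nat) (g : 'rV[R]_k -> R)
    (x : 'rV[R]_k) (e : R) : C1 g -> 0 < e ->
  exists2 r, 0 < r & forall i (z : 'rV[R]_k), (forall j, `|z 0 j - x 0 j| < r) ->
    `|partial i g z - partial i g x| <= e.
Proof.
move=> gC e0.
have : \forall z \near x, forall i, `|partial i g z - partial i g x| <= e.
  refine (@near_ord _ _ (nbhs x) _ _ _) => i.
  have /cvgrPdist_le/(_ _ e0) := (gC i).2 x.
  by apply: filterS => z; rewrite distrC.
move=> /nbhs_ballP[/= r r0 xr]; exists r => // i z zr.
by apply: (xr z); split => // a b; rewrite ord1 /ball /= distrC.
Qed.

Lemma C1_differential (R : realType) (k : nat) (g : 'rV[R]_k -> R) (x : 'rV[R]_k) (e : R) :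
  C1 g -> 0 < e ->
  \forall y \near x,
    `|g y - g x - \sum_i (y 0 i - x 0 i) * partial i g x| <= e * l1norm (y - x).
Proof.
move=> gC e0; have [r r0 xr] := partial_near_constant x gC e0.
apply/nbhs_ballP; exists r => //.
move=> y [_ yx]; under eq_bigr => i _.
  rewrite (_ : partial i g x = (gradient g x) 0 i); last by rewrite mxE.
  over.
apply: partials_increment => // i z zy; rewrite mxE; apply: xr => j.
by apply: le_lt_trans (zy j) _; have := yx 0 j; rewrite /ball /= distrC.
Qed.

(** The chain rule for a curve given by its coordinates: continuity of the partial
    derivatives makes [g] differentiable in the sense of [C1_differential], and the
    difference quotients of the coordinates stay bounded. *)
Lemma is_derive_curve (R : realType) (k : nat) (g : 'rV[R]_k -> R)
    (c : R -> 'rV[R]_k) (c' : 'rV[R]_k) (t : R) : C1 g ->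
  (forall i, is_derive t 1 (fun s => c s 0 i) (c' 0 i)) ->
  is_derive t 1 (g \o c) (\sum_i c' 0 i * partial i g (c t)).
Proof.
move=> gC cd.
have ch i : h^-1 *: (c (h + t) 0 i - c t 0 i) @[h --> 0^'] --> c' 0 i.
  have [] := cd i; rewrite /derivable /derive => /cvg_ex[l hl].
  have El : (fun h : R => h^-1 *: (((fun s => c s 0 i) \o shift t) (h *: 1) - c t 0 i))
    = (fun h => h^-1 *: (c (h + t) 0 i - c t 0 i)).
    by apply/funext => h; rewrite /= scaler1.
  by rewrite El in hl *; move=> <-; rewrite (cvg_lim _ hl).
have cc : c h @[h --> t] --> c t.
  apply/cvg_ballP => e e0.
  have : \forall h \near t, forall i, `|c t 0 i - c h 0 i| < e.
    refine (@near_ord _ _ (nbhs t) _ _ _) => i.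
    have /cvgrPdist_lt : {for t, continuous (fun s => c s 0 i)}.
      by apply/differentiable_continuous/derivable1_diffP; case: (cd i).
    exact.
  by apply: filterS => h ce; split => // a i; rewrite ord1; exact: ce.
pose q h := \sum_i h^-1 *: (c (h + t) 0 i - c t 0 i) * partial i g (c t).
have qc : q h @[h --> 0^'] --> \sum_i c' 0 i * partial i g (c t).
  apply: cvg_big => [|i _]; first exact: add_continuous.
  by apply: cvgM; [exact: ch|exact: cvg_cst].
have lim : h^-1 *: (((g \o c) \o shift t) (h *: 1) - (g \o c) t) @[h --> 0^'] -->
    \sum_i c' 0 i * partial i g (c t).
  rewrite -[X in _ --> X]addr0.
  rewrite [X in X @ _ --> _](_ : _ = (fun h => q h + (h^-1 *:
     (((g \o c) \o shift t) (h *: 1) - (g \o c) t) - q h))); last first.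
    by apply/funext => h; rewrite [RHS]addrC subrK.
  apply: cvgD => //; apply/cvgr0Pnorm_le => e e0.
  pose M := \sum_i (`|c' 0 i| + 1).
  have M0 : 0 <= M by apply: sumr_ge0 => i _; rewrite addr_ge0.
  have e1 : 0 < e / (M + 1) by rewrite divr_gt0// ltr_wpDl.
  have near1 : \forall h \near 0^', `|g (c (h + t)) - g (c t) -
      \sum_i (c (h + t) 0 i - c t 0 i) * partial i g (c t)|
      <= e / (M + 1) * l1norm (c (h + t) - c t).
    have ct : c (h + t) @[h --> 0^'] --> c t.
      apply: cvg_comp cc; apply: cvg_within_filter.
      have : (h + t) @[h --> 0] --> 0 + t by apply: cvgD; [exact: cvg_id|exact: cvg_cst].
      by rewrite add0r.
    exact: ct (C1_differential (c t) gC e1).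
  have near2 : \forall h \near 0^', forall i,
      `|h^-1 *: (c (h + t) 0 i - c t 0 i)| <= `|c' 0 i| + 1.
    refine (@near_ord _ _ (dnbhs 0) _ _ _) => i.
    have /cvgrPdist_le/(_ _ ltr01) := ch i.
    apply: filterS => h hle; rewrite -[X in `|X|](subrK (c' 0 i)) addrC.
    by apply: le_trans (ler_normD _ _) _; rewrite lerD2l distrC.
  near=> h.
  have h0 : h != 0 by near: h; exact: nbhs_dnbhs_neq.
  have n1 : `|h^-1| * `|g (c (h + t)) - g (c t) -
      \sum_i (c (h + t) 0 i - c t 0 i) * partial i g (c t)|
      <= `|h^-1| * (e / (M + 1) * l1norm (c (h + t) - c t)).
    by apply: ler_wpM2l => //; near: h.
  have n2 i : `|h^-1 *: (c (h + t) 0 i - c t 0 i)| <= `|c' 0 i| + 1.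
    by move: i; near: h.
  rewrite /= scaler1 /shift /q -[X in X - _]/(h^-1 * _).
  under eq_bigr do rewrite -[_ *: _]/(_ * _) -mulrA.
  rewrite -mulr_sumr -mulrBr normrM; apply: le_trans n1 _.
  rewrite mulrCA; apply: (@le_trans _ _ (e / (M + 1) * M)).
    rewrite ler_pM2l// mulr_sumr; apply: ler_sum => i _.
    by rewrite !mxE -normrM; exact: n2.
  have M1 : 0 < M + 1 by rewrite ltr_wpDl.
  by rewrite mulrAC ler_pdivrMr// ler_pM2l// lerDl.
split; first by apply/cvg_ex; exists (\sum_i c' 0 i * partial i g (c t)).
exact: cvg_lim lim.
Unshelve. all: by end_near. Qed.

Lemma is_derive_of_line (R : realType) (V : normedModType R) (g : V -> R) (z v : V) (d : R) :
  is_derive (0 : R) 1 (fun h => g (h *: v + z)) d -> is_derive z v g d.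
Proof.
have E : (fun h : R => h^-1 *: (((fun h => g (h *: v + z)) \o shift 0) (h *: 1)
    - g (0 *: v + z)))
  = (fun h : R => h^-1 *: ((g \o shift z) (h *: v) - g z)).
  by apply/funext => h /=; rewrite /shift /= scaler1 addr0 scale0r add0r.
by case; rewrite /derivable /derive E => ? <-.
Qed.

Lemma lipschitz_l1norm_continuous (R : realType) (k : nat) (f : 'rV[R]_k -> R) (B : R) :
  (forall x y, `|f x - f y| <= B * l1norm (x - y)) -> continuous f.
Proof.
move=> fB x; apply/(@cvgrPdist_le _ _ _ _ (nbhs_filter x)) => e e0.
pose C := `|B| * k%:R + 1; have C0 : 0 < C by rewrite ltr_wpDl ?mulr_ge0.
apply/nbhs_ballP; exists (e / C) => /=; first by rewrite divr_gt0.
move=> y [_ xy]; apply: le_trans (fB x y) _.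
apply: (@le_trans _ _ (`|B| * (k%:R * (e / C)))).
  apply: (@le_trans _ _ (`|B| * l1norm (x - y))).
    by rewrite ler_wpM2r ?l1norm_ge0 ?ler_norm.
  apply: ler_wpM2l => //.
  have -> : k%:R * (e / C) = \sum_(i < k) (e / C) by rewrite sumr_const card_ord mulr_natl.
  by apply: ler_sum => i _; rewrite !mxE; apply/ltW; exact: xy.
rewrite [leLHS]mulrA; apply: (@le_trans _ _ (C * (e / C))).
  by apply: ler_wpM2r; [apply/ltW; rewrite divr_gt0|rewrite lerDl].
by rewrite mulrCA divff ?mulr1// gt_eqF.
Qed.

Lemma l1normZ (R : realType) (k : nat) (c : R) (u : 'rV[R]_k) :
  l1norm (c *: u) = `|c| * l1norm u.
Proof. by rewrite mulr_sumr; apply: eq_bigr => i _; rewrite mxE normrM. Qed.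

(** * Compactly supported functions *)

Lemma compact_support_bounded (R : realType) (k : nat) (K : set 'rV[R]_k) (f : 'rV[R]_k -> R) :
  compact K -> continuous f -> (forall x, ~ K x -> f x = 0) ->
  exists2 M, 0 <= M & forall x, `|f x| <= M.
Proof.
move=> cK cf f0; have cfK : compact (f @` K).
  by apply: continuous_compact => //; apply/continuous_subspaceT.
have [M [Mreal MK]] := compact_bounded cfK.
exists (`|M| + 1); first by rewrite addr_ge0.
move=> x; have [Kx|Kx] := pselect (K x).
  by apply: MK; [rewrite ltr_pwDr// ler_norm|exists x].
by rewrite f0// normr0 addr_ge0.
Qed.

Lemma partial_eq0 (R : realType) (k : nat) (K : set 'rV[R]_k) (f : 'rV[R]_k -> R) i :
  closed K -> (forall x, ~ K x -> f x = 0) -> forall x, ~ K x -> partial i f x = 0.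
Proof.
move=> cK f0 x Kx; rewrite /partial (@near_eq_derive _ _ _ f (cst 0)) ?derive_cst//.
have : nbhs x (~` K) by apply: open_nbhs_nbhs; split => //; exact: closed_openC.
by apply: filterS => y Ky; rewrite f0.
Qed.

Section compact_support.
Context (R : realType) (k : nat) (g : 'rV[R]_k -> R).
Hypothesis gC2c : C2c g.

Let K := closure [set x | g x != 0].

Let g0 x : ~ K x -> g x = 0.
Proof.
by move=> Kx; apply/eqP; apply: contra_notT Kx => gx; exact: subset_closure.
Qed.

Let cK : closed K. Proof. exact: closed_closure. Qed.

Lemma C2c_C1 : C1 g.
Proof. by case: gC2c => -[]. Qed.

Lemma C2c_C1_partial j : C1 (partial j g).
Proof. by move=> i; case: gC2c => -[_ _ /(_ i j)]. Qed.

Lemma C2c_bounded : exists2 M, 0 <= M & forall x, `|g x| <= M.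
Proof. by case: gC2c => -[gc _ _] cpK; apply: compact_support_bounded cpK gc g0. Qed.

Lemma C2c_partial_bounded : exists2 M, 0 <= M & forall i x, `|partial i g x| <= M.
Proof.
have H i : exists M, 0 <= M /\ forall x, `|partial i g x| <= M.
  case: gC2c => -[_ gp _] cpK.
  have [M M0 MP] := compact_support_bounded cpK (gp i).2 (partial_eq0 _ cK g0).
  by exists M.
have [M MP] := choice H; exists (\sum_i M i); first by apply: sumr_ge0 => i _; case: (MP i).
move=> i x; apply: le_trans ((MP i).2 x) _.
by rewrite (bigD1 i)//= lerDl sumr_ge0// => j _; case: (MP j).
Qed.

Lemma hess_sup_ge0 : (0 <= hess_sup g)%E.
Proof. exact: bigmax_ge_id. Qed.

Lemma hess_sup_fin_num : hess_sup g \is a fin_num.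
Proof.
rewrite ge0_fin_numE ?hess_sup_ge0//; apply/bigmax_ltP; split => // i _.
apply/bigmax_ltP; split => // j _.
case: gC2c => -[_ _ gp] cpK.
have [M M0 MP] := compact_support_bounded cpK (gp i j).2 (partial_eq0 _ cK (partial_eq0 _ cK g0)).
apply: (@le_lt_trans _ _ M%:E); last exact: ltry.
by apply: ge_ereal_sup => _ [x _ <-]; rewrite lee_fin.
Qed.

Lemma hess_bound i j x : `|partial i (partial j g) x| <= fine (hess_sup g).
Proof.
rewrite -lee_fin fineK ?hess_sup_fin_num//.
apply: le_trans (le_bigmax _ _ i); apply: le_trans (le_bigmax _ _ j).
by apply: ereal_sup_ubound; exists x.
Qed.

Lemma partial_lipschitz j x y :
  `|partial j g x - partial j g y| <= fine (hess_sup g) * l1norm (x - y).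
Proof.
exact: lipschitz_l1norm (@C2c_C1_partial j) (fun i => @hess_bound i j) x y.
Qed.

End compact_support.

Lemma grad_sup_ge0 (R : realType) (k : nat) (g : 'rV[R]_k -> R) : (0 <= grad_sup g)%E.
Proof.
apply: (@le_trans _ _ (enorm (gradient g 0))%:E); first by rewrite lee_fin sqrtr_ge0.
by apply: ereal_sup_ubound; exists 0.
Qed.

(** * Measurability of functions of random vectors *)

(** A vector with real coordinates is within any positive distance of a rational one,
    so that an open set of row vectors is a countable union of open boxes with rational
    data; hence a continuous function of measurable coordinates is measurable. *)
Lemma measurable_fun_row (R : realType) (d : measure_display) (T : measurableType d)
    (k : nat) (f : 'rV[R]_k -> R) (Y : 'I_k -> T -> R) :
  continuous f -> (forall i, measurable_fun setT (Y i)) ->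
  measurable_fun setT (fun w => f (\row_i Y i w)).
Proof.
move=> cf mY mT; apply: (measurability (@RGenOInfty.G R) (RGenOInfty.measurableE R)) => //.
move=> /= _ [_ [a ->] <-]; rewrite setTI.
pose U := f @^-1` `]a, +oo[.
have oU : open U by apply: open_comp => // x _; exact: cf.
pose box (q : 'rV[rat]_k * nat) := [set w | forall i, `|Y i w - ratr (q.1 0 i)| < q.2.+1%:R^-1].
pose good (q : 'rV[rat]_k * nat) :=
  forall x : 'rV[R]_k, (forall i, `|x 0 i - ratr (q.1 0 i)| < q.2.+1%:R^-1) -> U x.
pose F q := if `[< good q >] then box q else set0.
rewrite (_ : _ @^-1` _ = \bigcup_q F q); last first.
  apply/seteqP; split => [w /= faw|w [q _]]; last first.
    by rewrite /F; case: asboolP => // gq bq; apply: gq => i; rewrite mxE; exact: bq.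
  have /nbhs_ballP[e /= e0 eU] : nbhs (\row_i Y i w) U by apply: open_nbhs_nbhs.
  have [m me] : exists m : nat, m.+1%:R^-1 < e / 2.
    have e2 : 0 < e / 2 by rewrite divr_gt0.
    have [m _ /(_ _ (leqnn _)) mm] := near_infty_natSinv_lt (PosNum e2).
    by exists m.
  have m0 : 0 < m.+1%:R^-1 :> R by rewrite invr_gt0.
  have H i : exists q : rat, `|Y i w - ratr q| < m.+1%:R^-1.
    have /rat_in_itvoo[q] : Y i w - m.+1%:R^-1 < Y i w + m.+1%:R^-1.
      by rewrite ltrD2l gtrN.
    by rewrite in_itv /= => /andP[q1 q2]; exists q; rewrite distrC ltr_distl q1 q2.
  have [q qP] := choice H.
  exists ((\row_i q i), m) => //; rewrite /F asboolT.
    by move=> i /=; rewrite mxE.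
  move=> x xq; apply: eU; split => // b i; rewrite ord1 /ball /= mxE.
  have := xq i; rewrite /= mxE => xi; have Yi := qP i.
  rewrite -(subrK (ratr (q i)) (Y i w)) -addrA.
  apply: le_lt_trans (ler_normD _ _) _; rewrite (splitr e).
  by apply: ltrD; [exact: lt_trans me|rewrite distrC; exact: lt_trans me].
apply: countable_bigcupT_measurable => [|q]; first exact: countableP.
rewrite /F; case: asboolP => _; last exact: measurable0.
rewrite (_ : box q = \bigcap_(i in [set: 'I_k]) (Y i @^-1` ball (ratr (q.1 0 i) : R) q.2.+1%:R^-1)).
  apply: fin_bigcap_measurable => [|i _]; first exact: finite_finset.
  rewrite -[X in measurable X]setTI; apply: mY => //; exact: measurable_ball.
by apply/seteqP; split => [w bw i _|w bw i]; [|have := bw i Logic.I]; rewrite /= /ball /= distrC.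
Qed.

(** * Resampling one of several independent variables *)

Lemma integral_law (d d1 : measure_display) (T : measurableType d)
    (T1 : measurableType d1) (R : realType) (P : probability T R)
    (U : {mfun T >-> T1}) (f : T1 -> \bar R) : measurable_fun setT f ->
  (\int[distribution P U]_x f x = \int[P]_w f (U w))%E.
Proof.
move=> mf; rewrite integralE [RHS]integralE; congr (_ - _)%E.
- apply: etrans (ge0_integral_distribution (P := P) U (measurable_funepos mf) _) _ => //.
  by rewrite (funepos_comp f U).
- apply: etrans (ge0_integral_distribution (P := P) U (measurable_funeneg mf) _) _ => //.
  by rewrite (funeneg_comp f U).
Qed.

Section independent_pair.
Context (d d1 d2 : measure_display) (T : measurableType d) (T1 : measurableType d1)
  (T2 : measurableType d2) (R : realType) (P : probability T R)
  (U : {mfun T >-> T1}) (V : {mfun T >-> T2}).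
Hypothesis UV_indep : forall A B, measurable A -> measurable B ->
  P (U @^-1` A `&` V @^-1` B) = (P (U @^-1` A) * P (V @^-1` B))%E.

Let UV : {mfun T >-> (T1 * T2)%type}.
Proof.
exists (fun w => (U w, V w)); split; split.
by apply: measurable_fun_pair; exact: measurable_funPT.
Defined.

Let law_UV C : measurable C ->
  (distribution P U \x distribution P V)%E C = distribution P UV C.
Proof. by apply: product_measure_unique => A B mA mB; exact: UV_indep. Qed.

(** The joint law of independent variables is a product measure, so that the two may
    be integrated one after the other, over separate copies of the sample space. *)
Lemma integral_indep_pair (F : T1 * T2 -> \bar R) : measurable_fun setT F ->
  P.-integrable setT (fun w => F (U w, V w)) ->
  (\int[P]_w F (U w, V w) = \int[P]_w' \int[P]_w F (U w', V w))%E.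
Proof.
move=> mF intF.
have iF : (distribution P U \x distribution P V)%E.-integrable setT F.
  apply/integrableP; split => //.
  rewrite (eq_measure_integral (distribution P UV)); last by move=> C mC _; exact: law_UV.
  rewrite ge0_integral_distribution//; last exact: measurableT_comp.
  by case/integrableP: intF.
transitivity (\int[distribution P UV]_z F z)%E; first by rewrite integral_distribution.
rewrite (eq_measure_integral (distribution P U \x distribution P V)%E); last first.
  by move=> C mC _; apply/esym; exact: law_UV.
rewrite -integral12_prod_meas1//.
have FE x : (fubini_F (distribution P V) F x = \int[P]_w F (x, V w))%E.
  by apply: integral_law; apply: measurableT_comp mF _; exact: pair1_measurable.
rewrite integral_law; first by apply: eq_integral => w' _ /=; rewrite FE.
exact: measurable_int (integrable_fubini_F iF).
Qed.
End independent_pair.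

Section independent_coordinate.
Context (d : measure_display) (T : measurableType d) (R : realType)
  (P : probability T R) (n : nat) (X : 'I_n -> {RV P >-> R}) (r : 'I_n).
Hypothesis Xindep : mutually_independent P X.

(** The events that constrain the coordinates other than [r] one by one: a family
    stable under intersection that generates the sigma-algebra of these coordinates. *)
Definition other_boxes : set (set T) :=
  [set B | exists2 A : 'I_n -> set R, (forall i, measurable (A i)) &
     B = \bigcap_(i in [set` [set~ r]%SET]) X i @^-1` A i].

Let G := other_boxes.

Let mX i A : measurable A -> measurable (X i @^-1` A).
Proof. by move=> mA; rewrite -[_ @^-1` _]setTI; exact: measurable_funPT. Qed.

Let G_measurable : G `<=` measurable.
Proof.
move=> _ [A mA ->]; apply: fin_bigcap_measurable => [|i _]; first exact: finite_finset.
exact: mX.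
Qed.

Let sG_measurable : <<s G >> `<=` measurable.
Proof. exact: smallest_sub (@sigma_algebra_measurable _ T) G_measurable. Qed.

Let G_setT : G setT.
Proof.
exists (fun=> setT) => //; apply/seteqP; split => // w _ i _.
Qed.

Let G_setI : setI_closed G.
Proof.
move=> _ _ [A mA ->] [B mB ->]; exists (fun i => A i `&` B i).
  by move=> i; exact: measurableI.
apply/seteqP; split => [w [wA wB] i ir|w wAB].
  by split; [exact: wA|exact: wB].
by split => i ir; have [] := wAB i ir.
Qed.

Let X_measurable_others i : i != r ->
  measurable_fun setT (X i : g_sigma_algebraType G -> R).
Proof.
move=> ir _ A mA; rewrite setTI; apply: sub_sigma_algebra.
exists (fun j => if j == i then A else setT); first by move=> j; case: ifP.
apply/seteqP; split => [w wA j _|w wA] /=; first by case: eqVneq => // ->.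
by have := wA i; rewrite /= eqxx; apply; rewrite !inE.
Qed.

Lemma indep_others A B : measurable A -> <<s G >> B ->
  P (X r @^-1` A `&` B) = (P (X r @^-1` A) * P B)%E.
Proof.
move=> mA sB; have mXA := mX r mA.
have p0 : 0 <= fine (P (X r @^-1` A)) by exact: fine_ge0.
pose p : {nonneg R} := NngNum p0.
have fE : P (X r @^-1` A) = (fine (P (X r @^-1` A)))%:E.
  by rewrite fineK//; exact: fin_num_measure.
suff : mrestr P mXA B = mscale p P B by rewrite /mrestr /mscale setIC => ->; rewrite /= -fE.
apply: (g_sigma_algebra_measure_unique G G_measurable (fun=> setT)) => //.
- by rewrite bigcup_const//; exists 0%N.
- move=> _ [C mC ->]; rewrite /= /mrestr /mscale /= -fE.
  pose C' i := if i == r then A else C i.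
  have mC' i : measurable (C' i) by rewrite /C'; case: ifP.
  rewrite Xindep//; have := @Xindep [set: 'I_n]%SET C' mC'.
  rewrite (bigD1 r) ?inE//= {2}/C' eqxx.
  rewrite (eq_bigl (fun i => i \in [set~ r]%SET)); last by move=> i; rewrite !inE.
  rewrite (eq_bigr (fun i => P (X i @^-1` C i))); last first.
    by move=> i; rewrite !inE /C' => /negbTE ->.
  move=> <-; congr (P _); apply/seteqP; split => [w [wC wA] i _|w wC'].
    rewrite /C' /=; case: eqVneq => [->//|ir]; apply: wC.
    by rewrite /= !inE.
  split; last by have := wC' r; rewrite /C' /= eqxx; apply; rewrite /= !inE.
  by move=> i; rewrite /= !inE => ir; have := wC' i; rewrite /C' /= (negbTE ir); apply; rewrite /= !inE.
- by move=> _; rewrite /= /mrestr setTI ltey_eq fin_num_measure.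
Qed.

Local Notation TG := (g_sigma_algebraType G).


Let idG : {mfun T >-> TG}.
Proof.
exists (fun w : T => w : TG); split; split.
by move=> _ A mA; rewrite setTI; exact: sG_measurable.
Defined.

Definition set_coord (x : 'rV[R]_n) (t : R) : 'rV[R]_n :=
  \row_i (if i == r then t else x 0 i).

Lemma fresh_copy_ereal (f : 'rV[R]_n -> R) : continuous f ->
  P.-integrable setT (fun w => (f (random_vector X w))%:E) ->
  (\int[P]_w (f (random_vector X w))%:E =
   \int[P]_w' \int[P]_w (f (set_coord (random_vector X w') (X r w)))%:E)%E.
Proof.
move=> cf intf.
pose F (z : TG * R) : \bar R := (f (\row_i (if i == r then z.2 else X i z.1)))%:E.
have mF : measurable_fun setT F.
  apply/measurable_EFinP.
  apply: (@measurable_fun_row R _ (TG * R)%type n f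
     (fun i z => if i == r then z.2 else X i z.1)) => // i.
  case: eqVneq => [_|ir]; first exact: measurable_snd.
  by apply: measurableT_comp (X_measurable_others ir) _; exact: measurable_fst.
have FE w : (f (random_vector X w))%:E = F (idG w, X r w).
  by congr (f _)%:E; apply/rowP => i; rewrite !mxE; case: eqVneq => // ->.
under eq_integral do rewrite FE.
rewrite (integral_indep_pair (U := idG) (V := X r) _ mF).
- apply: eq_integral => w' _; apply: eq_integral => w _; congr (f _)%:E.
  by apply/rowP => i; rewrite !mxE.
- by move=> B A sB mA; rewrite setIC indep_others// muleC.
- by apply: eq_integrable intf.
Qed.

End independent_coordinate.
(** The vector of the other coordinates and the coordinate [r] are independent, hence
    [integral_indep_pair] applies: one coordinate may be drawn afresh. *)
Lemma fresh_copy (d : measure_display) (T : measurableType d) (R : realType)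
    (P : probability T R) (n : nat) (X : 'I_n -> {RV P >-> R}) (r : 'I_n)
    (f : 'rV[R]_n -> R) :
  mutually_independent P X -> continuous f ->
  P.-integrable setT (fun w => (f (random_vector X w))%:E) ->
  (forall x, P.-integrable setT (fun w => (f (set_coord r x (X r w)))%:E)) ->
  \int[P]_w f (random_vector X w) =
  \int[P]_w' \int[P]_w f (set_coord r (random_vector X w') (X r w)).
Proof.
move=> Xindep cf intf intr; rewrite /Rintegral (fresh_copy_ereal r)//.
congr fine; apply: eq_integral => w' _.
by rewrite fineK//; exact: integrable_fin_num (intr _).
Qed.

(** * The standard normal law *)

Section standard_normal_law.
Context (R : realType).
Local Notation mu := (@lebesgue_measure R).
Local Notation gauss := (normal_prob (0 : R) 1).
Local Notation phi := (normal_pdf (0 : R) 1).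

Let phiE x : phi x = normal_peak 1 * expR (- x ^+ 2 / 2).
Proof. by rewrite normal_pdfE ?oner_neq0// /normal_fun subr0 expr1n. Qed.

Let phi_ge0 x : 0 <= phi x. Proof. exact: normal_pdf_ge0. Qed.

Let phi_meas : measurable_fun setT phi. Proof. exact: measurable_normal_pdf. Qed.

Let phi_cont : continuous phi.
Proof. by apply: continuous_normal_pdf; exact: oner_neq0. Qed.

Lemma is_derive_normal_pdf (x : R) : is_derive x 1 phi (- x * phi x).
Proof.
have -> : phi = (fun x => normal_peak 1 * expR (- x ^+ 2 / 2)).
  by apply/funext => y; exact: phiE.
have dq : is_derive x 1 (fun y : R => - y ^+ 2 / 2) (- x).
  rewrite (_ : (fun y => _) = (fun y => (- 2^-1) *: (id ^+ 2) y)); last first.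
    by apply/funext => y /=; rewrite -[_ *: _]/(_ * _) fctE mulNr mulrC mulNr.
  have d2 := is_deriveX 2 (is_derive_id x (1 : R)).
  have d3 := is_deriveZ (- 2^-1) d2.
  apply: is_derive_eq d3 _; rewrite /= !scalerA -[_ *: _]/(_ * _) expr1.
  by rewrite mulr1 /=; lra.
have de := @is_derive1_comp R expR (fun y => - y ^+ 2 / 2) x _ _ (is_derive_expR _) dq.
have dz := is_deriveZ (normal_peak 1) de.
apply: is_derive_eq dz _; rewrite -[_ *: _]/(_ * _) /=.
by ring.
Qed.

Lemma normal_pdf_cvgy : phi x @[x --> +oo] --> 0.
Proof.
have key : normal_peak 1 * expR (- x) @[x --> +oo] --> (0 : R).
  by rewrite -(mulr0 (normal_peak 1)); apply: cvgMr; exact: cvgr_expR.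
apply: (@squeeze_cvgr _ _ _ _ (cst 0) _ _ _ _ _ key); last exact: cvg_cst.
near=> x; rewrite phi_ge0 phiE ler_wpM2l ?normal_peak_ge0// ler_expR.
have x2 : 2 <= x by near: x; exact: nbhs_pinfty_ge.
by nra.
Unshelve. all: by end_near. Qed.

Lemma normal_pdfN x : phi (- x) = phi x.
Proof. by rewrite !phiE sqrrN. Qed.

Lemma normal_pdf_cvgNy : phi x @[x --> -oo] --> 0.
Proof.
apply/cvgNy_compNP; rewrite (_ : phi \o -%R = phi); first exact: normal_pdf_cvgy.
by apply/funext => x; exact: normal_pdfN.
Qed.

(** The Radon-Nikodym derivative of [normal_prob] is almost everywhere its density, both
    having the same integrals over measurable sets. *)
Lemma ge0_integral_normal_prob (f : R -> \bar R) : measurable_fun setT f ->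
  (forall x, (0 <= f x)%E) ->
  (\int[gauss]_x f x = \int[mu]_x (f x * (phi x)%:E))%E.
Proof.
move=> mf f0; have dom := normal_prob_dominates (0 : R) 1.
rewrite -(Radon_Nikodym_SigmaFinite.change_of_variables dom)//.
have intf := Radon_Nikodym_SigmaFinite.f_integrable dom.
apply: ae_eq_integral => //.
- by apply: emeasurable_funM => //; exact: measurable_int intf.
- by apply: emeasurable_funM => //; exact/measurable_EFinP.
- apply: ae_eqe_mul2l; apply: integral_ae_eq => //.
  + exact/measurable_EFinP.
  + by move=> E _ mE; rewrite -(Radon_Nikodym_SigmaFinite.f_integral dom).
Qed.

Lemma integrable_normal_prob (f : R -> R) : gauss.-integrable setT (EFin \o f) ->
  mu.-integrable setT (fun x => (f x * phi x)%:E).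
Proof.
move=> /integrableP[/measurable_EFinP mf intf]; apply/integrableP; split.
  by apply/measurable_EFinP; exact: measurable_funM.
move: intf; rewrite ge0_integral_normal_prob//; last first.
  by apply: measurableT_comp => //; exact/measurable_EFinP.
by under [in X in _ -> X]eq_integral do rewrite EFinM abseM (gee0_abs (x := (phi _)%:E)) ?lee_fin//.
Qed.

Lemma integral_normal_prob (f : R -> R) : measurable_fun setT f ->
  \int[gauss]_x f x = \int[mu]_x (f x * phi x).
Proof.
move=> mf; rewrite /Rintegral integralE [in RHS]integralE.
have mEf : measurable_fun setT (EFin \o f) by exact/measurable_EFinP.
congr (fine (_ - _)).
- rewrite ge0_integral_normal_prob//; last exact: measurable_funepos.
  apply: eq_integral => x _; rewrite !funeposE EFinM.
  by rewrite maxe_pMl// ?mul0e ?lee_fin.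
- rewrite ge0_integral_normal_prob//; last exact: measurable_funeneg.
  apply: eq_integral => x _; rewrite !funenegE EFinM.
  by rewrite maxe_pMl// ?mul0e ?mulNe ?lee_fin.
Qed.
End standard_normal_law.

(** The integral of a derivative over [[- n, n]] is a difference of boundary values, which
    vanishes in the limit; dominated convergence identifies the limit. *)
Lemma integral_derivative_eq0 (R : realType) (u u' : R -> R) :
  (forall x : R, is_derive x 1 u (u' x)) -> continuous u' ->
  (@lebesgue_measure R).-integrable setT (EFin \o u') ->
  u x @[x --> +oo] --> 0 -> u x @[x --> -oo] --> 0 ->
  \int[@lebesgue_measure R]_x u' x = 0.
Proof.
move=> du cu' iu' uy uNy; set mu := @lebesgue_measure R.
pose f n := (EFin \o u') \_ `[- n%:R, n%:R].
have mu' : measurable_fun setT (EFin \o u') := measurable_int _ iu'.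
have fcvg x : f ^~ x @ \oo --> (u' x)%:E.
  apply: cvg_near_cst; near=> n; rewrite /f patchE mem_set//= in_itv/= -ler_norml.
  by near: n; exact: nbhs_infty_ger.
have [|||||_ _] := @dominated_convergence _ _ _ mu setT measurableT f (EFin \o u')
    (abse \o (EFin \o u')).
- by move=> n; apply/(measurable_restrictT _ _).1 => //; exact: measurable_funS mu'.
- by [].
- by apply: aeW => x _; exact: fcvg.
- exact: integrable_abse.
- apply: aeW => x n _; rewrite /f patchE; case: ifP => //= _.
  by rewrite normr0 lee_fin.
have -> : (fun n => \int[mu]_(x in setT) f n x)%E =
    (fun n => (u n%:R - u (- n%:R))%:E).
  apply/funext => n; rewrite /f -integral_mkcond; case: n => [|n].
    by rewrite oppr0 subrr set_itv1 integral_set1.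
  rewrite (continuous_FTC2 (F := u))// ?EFinB//.
  - by rewrite gtrN.
  - exact: continuous_subspaceT.
  - split.
    + by move=> x _; case: (du x).
    + apply: cvg_at_right_filter; apply: differentiable_continuous.
      by apply/derivable1_diffP; case: (du (- n.+1%:R)).
    + apply: cvg_at_left_filter; apply: differentiable_continuous.
      by apply/derivable1_diffP; case: (du n.+1%:R).
  - by move=> x _; rewrite derive1E; case: (du x).
move=> lim1.
have lim0 : (u n%:R - u (- n%:R))%:E @[n --> \oo] --> (0 : R)%:E.
  apply: cvg_EFin; first exact: nearW.
  rewrite -[X in _ --> X](subrr 0); apply: cvgB.
    exact: cvg_comp (@cvgr_idn R) uy.
  by apply: cvg_comp uNy; have /cvgNrNy := @cvgr_idn R; exact.
have E := etrans (esym (cvg_lim (@ereal_hausdorff R) lim1)) (cvg_lim (@ereal_hausdorff R) lim0).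
by move: E; rewrite /Rintegral /comp => E; rewrite E.
Unshelve. all: by end_near. Qed.

Section standard_normal_moments.
Context (R : realType).
Local Notation mu := (@lebesgue_measure R).
Local Notation gauss := (normal_prob (0 : R) 1).
Local Notation phi := (normal_pdf (0 : R) 1).

(** By symmetry the moment is twice the integral of [x phi x] over the half-line, where
    [- phi] is an antiderivative; so it is [2 phi 0 = sqrt (2 / pi)]. *)
Lemma normal_abs_moment : (\int[gauss]_x `|x|%:E <= 1)%E.
Proof.
have mabs : measurable_fun setT (fun x : R => `|x|%:E).
  by apply/measurable_EFinP; exact: normr_measurable.
rewrite ge0_integral_normal_prob//.
have phi_cont : continuous phi by apply: continuous_normal_pdf; exact: oner_neq0.
rewrite (_ : (\int[mu]_x _ = \int[mu]_x (`|x| * phi x)%:E)%E)//.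
rewrite ge0_symfun_integralT.
- rewrite -set_itvcy (ge0_continuous_FTC2y (f := fun x => `|x| * phi x)
    (F := fun x => - phi x) (a := 0) (l := 0))//.
  + rewrite sub0e EFinN oppeK -EFinM lee_fin normal_pdfE ?oner_neq0//.
    rewrite /normal_fun subr0 expr0n/= oppr0 mul0r expR0 mulr1 /normal_peak.
    rewrite expr1n mul1r ler_pdivrMr ?sqrtr_gt0 ?mul1r; last first.
      by rewrite mulrn_wgt0// pi_gt0.
    rewrite -[leLHS](ger0_norm (ler0n _ _)) -sqrtr_sqr ler_sqrt.
      by have := pi_ge2 R; lra.
    by rewrite mulrn_wge0// pi_ge0.
  + by move=> x x0; rewrite mulr_ge0// normal_pdf_ge0.
  + apply: continuous_subspaceT => x; apply: cvgM; last exact: phi_cont.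
    exact: norm_continuous.
  + by have := cvgN (@normal_pdf_cvgy R); rewrite oppr0; exact.
  + by move=> x _; apply: derivableN; case: (is_derive_normal_pdf x).
  + by apply: cvg_at_right_filter; apply: cvgN; exact: phi_cont.
  + move=> x; rewrite in_itv/= andbT => x0; rewrite derive1E.
    have := is_deriveN (is_derive_normal_pdf x).
    by case=> _ /= ->; rewrite gtr0_norm// mulNr opprK.
- by move=> x; rewrite mulr_ge0// normal_pdf_ge0.
- by move=> x; apply: cvgM; [exact: norm_continuous|exact: phi_cont].
- by move=> x /=; rewrite normrN normal_pdfN.
Qed.

Lemma integrable_normal_id : gauss.-integrable setT (fun x => x%:E).
Proof.
apply/integrableP; split; first by apply/measurable_EFinP.
by apply: le_lt_trans normal_abs_moment _; exact: ltry.
Qed.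

(** The difference of the two integrands, times the density [phi], is the derivative of
    the function [h phi], which vanishes at infinity. *)
Lemma stein_identity (h h' : R -> R) (M : R) :
  (forall x : R, is_derive x 1 h (h' x)) -> continuous h' ->
  (forall x, `|h x| <= M) -> (forall x, `|h' x| <= M) ->
  \int[gauss]_x (x * h x) = \int[gauss]_x h' x.
Proof.
move=> dh ch' hM h'M.
have ch : continuous h.
  by move=> x; apply/differentiable_continuous/derivable1_diffP; case: (dh x).
have mh : measurable_fun setT h by exact: continuous_measurable_fun.
have mh' : measurable_fun setT h' by exact: continuous_measurable_fun.
have phi_cont : continuous phi by apply: continuous_normal_pdf; exact: oner_neq0.
have ixh : gauss.-integrable setT (EFin \o (fun x => x * h x)).
  apply: (le_integrable measurableT _ _ (integrableZl measurableT M integrable_normal_id)).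
    by apply/measurable_EFinP; exact: measurable_funM.
  move=> x _; rewrite /= lee_fin !normrM mulrC ler_wpM2r//.
  exact: le_trans (hM x) (ler_norm _).
have ih' : gauss.-integrable setT (EFin \o h').
  apply: (le_integrable measurableT _ _ (finite_measure_integrable_cst gauss M measurableT)).
    exact/measurable_EFinP.
  by move=> x _; rewrite /= lee_fin (le_trans (h'M x))// ler_norm.
rewrite !integral_normal_prob//; last exact: measurable_funM.
apply/eqP; rewrite eq_sym -subr_eq0; apply/eqP.
have i1 := integrable_normal_prob ih'; have i2 := integrable_normal_prob ixh.
rewrite -RintegralB//.
have decay (F : set_system R) (FF : Filter F) :
    phi x @[x --> F] --> 0 -> h x * phi x @[x --> F] --> 0.
  move=> phi0; have phiM : M * phi x @[x --> F] --> 0.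
    by have := cvgM (cvg_cst M) phi0; rewrite mulr0; exact.
  have phiMN : - (M * phi x) @[x --> F] --> (0 : R).
    by have := cvgN phiM; rewrite oppr0; exact.
  apply: (squeeze_cvgr _ phiMN phiM); apply: nearW => x.
  rewrite -ler_norml normrM (ger0_norm (normal_pdf_ge0 _ _ _)).
  by rewrite ler_wpM2r ?normal_pdf_ge0.
apply: (@integral_derivative_eq0 R (fun x => h x * phi x)).
- move=> x; have d := is_deriveM (dh x) (is_derive_normal_pdf x).
  by apply: is_derive_eq d _; rewrite /= -![_ *: _]/(_ * _); ring.
- move=> x; apply: cvgB; first by apply: cvgM; [exact: ch'|exact: phi_cont].
  apply: cvgM; last exact: phi_cont.
  by apply: cvgM; [exact: cvg_id|exact: ch].
- by have := integrableB measurableT i1 i2; apply: eq_integrable.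
- exact: decay (@normal_pdf_cvgy R).
- exact: decay (@normal_pdf_cvgNy R).
Qed.
End standard_normal_moments.

(** * Bounds on integrals *)

Lemma Rintegral_cst_probability (d : measure_display) (T : measurableType d)
    (R : realType) (P : probability T R) (c : R) : \int[P]_x c = c.
Proof.
rewrite Rintegral_cst// [X in fine X](_ : _ = 1%E) ?mulr1//.
exact: probability_setT.
Qed.

Lemma integrable_dominated (d : measure_display) (T : measurableType d) (R : realType)
    (mu : {measure set T -> \bar R}) (f h : T -> R) :
  measurable_fun setT f -> mu.-integrable setT (EFin \o h) ->
  (forall x, `|f x| <= h x) -> mu.-integrable setT (EFin \o f).
Proof.
move=> mf ih fh; apply: (le_integrable measurableT _ _ ih); first exact/measurable_EFinP.
by move=> x _; rewrite /= lee_fin (le_trans (fh x))// ler_norm.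
Qed.

Lemma integrable_bounded (d : measure_display) (T : measurableType d) (R : realType)
    (P : probability T R) (f : T -> R) (M : R) :
  measurable_fun setT f -> (forall x, `|f x| <= M) -> P.-integrable setT (EFin \o f).
Proof.
by move=> mf; apply: integrable_dominated mf (finite_measure_integrable_cst P M measurableT).
Qed.

Lemma normr_Rintegral_le (d : measure_display) (T : measurableType d) (R : realType)
    (mu : {measure set T -> \bar R}) (f h : T -> R) :
  measurable_fun setT f -> mu.-integrable setT (EFin \o h) ->
  (forall x, `|f x| <= h x) -> `|\int[mu]_x f x| <= \int[mu]_x h x.
Proof.
move=> mf ih fh; have jf := integrable_dominated mf ih fh.
apply: le_trans (le_normr_Rintegral measurableT jf) _.
apply: le_Rintegral => //; apply: (integrable_dominated _ ih) => [|x].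
  exact: measurableT_comp.
by rewrite normr_id.
Qed.

Lemma normr_Rintegral_bounded (d : measure_display) (T : measurableType d) (R : realType)
    (P : probability T R) (f : T -> R) (M : R) :
  measurable_fun setT f -> (forall x, `|f x| <= M) -> `|\int[P]_x f x| <= M.
Proof.
move=> mf fM; have := normr_Rintegral_le mf (finite_measure_integrable_cst P M measurableT) fM.
by rewrite Rintegral_cst_probability.
Qed.

Lemma integrable_sum_ord (d : measure_display) (T : measurableType d) (R : realType)
    (mu : {measure set T -> \bar R}) (k : nat) (f : 'I_k -> T -> R) :
  (forall i, mu.-integrable setT (EFin \o f i)) ->
  mu.-integrable setT (EFin \o (fun x => \sum_(i < k) f i x)).
Proof.
move=> fi; rewrite (_ : EFin \o _ = fun x => (\sum_(i < k) (EFin \o f i) x)%E).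
  by apply: integrable_sum => // i _; exact: fi.
by apply/funext => x; rewrite /= sumEFin.
Qed.

Lemma Rintegral_sum_ord (d : measure_display) (T : measurableType d) (R : realType)
    (mu : {measure set T -> \bar R}) (k : nat) (f : 'I_k -> T -> R) :
  (forall i, mu.-integrable setT (EFin \o f i)) ->
  \int[mu]_x (\sum_(i < k) f i x) = \sum_(i < k) \int[mu]_x f i x.
Proof.
elim: k f => [|k IH] f fi.
  by under eq_Rintegral do rewrite big_ord0; rewrite Rintegral_cst// mul0r big_ord0.
under eq_Rintegral do rewrite big_ord_recr.
rewrite RintegralD//; first by rewrite IH// big_ord_recr.
exact: integrable_sum_ord.
Qed.

(** * Gaussian integration by parts *)

Lemma continuous_mul (R : realType) (T : topologicalType) (f g : T -> R) :
  continuous f -> continuous g -> continuous (fun x => f x * g x).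
Proof. by move=> cf cg x; apply: cvgM; [exact: cf|exact: cg]. Qed.

Lemma row_coord_continuous (R : realType) (k : nat) (i : 'I_k) :
  continuous (fun x : 'rV[R]_k => x 0 i).
Proof. by move=> x; exact/differentiable_continuous/differentiable_coord. Qed.

(** The same variable, for the copy of the Borel sigma-algebra on which the measure
    [normal_prob] lives. *)
Definition borel_copy (d : measure_display) (T : measurableType d) (R : realType)
    (P : probability T R) (Y : {RV P >-> R}) : {mfun T >-> measurableTypeR R} :=
  MeasurableFun.Pack (MeasurableFun.Class (isMeasurableFun.Build _ _ T
    (measurableTypeR R) (fun w => Y w) (@measurable_funPT _ _ _ _ Y))).

Section gaussian_vector.
Context (d : measure_display) (T : measurableType d) (R : realType)
  (P : probability T R) (k : nat) (Z : 'I_k -> {RV P >-> R}).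
Hypothesis Znormal : standard_normal P Z.
Local Notation gauss := (normal_prob (0 : R) 1).

Let mZ i : measurable_fun setT (Z i). Proof. exact: measurable_funPT. Qed.

Lemma integral_normal_coord i (f : R -> \bar R) : measurable_fun setT f ->
  (\int[P]_w f (Z i w) = \int[gauss]_x f x)%E.
Proof.
move=> mf; rewrite -(eq_measure_integral gauss (m1 := distribution P (borel_copy (Z i)))).
  exact: esym (integral_law P (borel_copy (Z i)) mf).
by move=> A mA _; exact: Znormal.2.
Qed.

Lemma Rintegral_normal_coord i (f : R -> R) : measurable_fun setT f ->
  \int[P]_w f (Z i w) = \int[gauss]_x f x.
Proof.
move=> mf; congr fine; apply: (@integral_normal_coord i (EFin \o f)).
exact/measurable_EFinP.
Qed.

Lemma integrable_normal_coord i : P.-integrable setT (EFin \o Z i).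
Proof.
apply/integrableP; split; first exact/measurable_EFinP.
rewrite (@integral_normal_coord i (fun x => `|x%:E|)%E).
  by case/integrableP: (integrable_normal_id R).
by apply/measurable_EFinP; exact: normr_measurable.
Qed.

Lemma normal_coord_abs_le1 i : \int[P]_w `|Z i w| <= 1.
Proof.
rewrite (@Rintegral_normal_coord i (fun x => `|x|)); last exact: normr_measurable.
have := normal_abs_moment R; rewrite /Rintegral => h.
rewrite -lee_fin fineK// ge0_fin_numE; last by apply: integral_ge0.
by apply: le_lt_trans h _; exact: ltry.
Qed.

(** Integration by parts: after resampling the coordinate [i], the inner integral is
    one over a standard normal variable, to which Stein's identity applies. *)
Lemma gaussian_ibp (f : 'rV[R]_k -> R) (M : R) i : C1 f -> continuous f ->
  (forall x, `|f x| <= M) -> (forall x, `|partial i f x| <= M) ->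
  \int[P]_w (Z i w * f (random_vector Z w)) =
  \int[P]_w partial i f (random_vector Z w).
Proof.
move=> fC cf fM dfM; have cdf := (fC i).2.
have cif : continuous (fun x : 'rV[R]_k => x 0 i * f x).
  exact: continuous_mul (@row_coord_continuous R k i) cf.
have mf : measurable_fun setT (fun w => f (random_vector Z w)) by exact: measurable_fun_row.
have mfx g x : continuous g -> measurable_fun setT (fun w => g (set_coord i x (Z i w)) : R).
  move=> cg; apply: (@measurable_fun_row R _ _ k g (fun j w => if j == i then Z i w else x 0 j)) => // j.
  by case: (j == i); [exact: mZ|exact: measurable_cst].
have dom : P.-integrable setT (EFin \o (fun w => `|Z i w| * M)).
  by have := integrableZr measurableT M (integrable_abse (integrable_normal_coord i)).
have E1 : \int[P]_w (Z i w * f (random_vector Z w)) =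
    \int[P]_w' \int[P]_w (Z i w * f (set_coord i (random_vector Z w') (Z i w))).
  have := @fresh_copy _ _ _ P k Z i (fun x => x 0 i * f x) Znormal.1 cif.
  under [in X in _ -> _ -> X = _]eq_Rintegral do rewrite mxE.
  move=> ->; first by apply: eq_Rintegral => w' _; apply: eq_Rintegral => w _; rewrite mxE eqxx.
  - apply: (integrable_dominated (h := fun w => `|Z i w| * M)) => //.
      exact: (measurable_fun_row cif).
    by move=> w; rewrite mxE normrM ler_wpM2l.
  - move=> x; apply: (integrable_dominated (h := fun w => `|Z i w| * M)) => //.
      exact: (mfx _ x cif).
    by move=> w; rewrite mxE eqxx normrM ler_wpM2l.
rewrite E1 (@fresh_copy _ _ _ P k Z i _ Znormal.1 cdf) => [||x]; first last.
- apply: (@integrable_bounded _ _ _ _ _ M) => [|w]; [exact: (mfx _ _ cdf)|exact: dfM].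
- apply: (@integrable_bounded _ _ _ _ _ M) => [|w]; [exact: (measurable_fun_row cdf)|exact: dfM].
apply: eq_Rintegral => w' _; set x := random_vector Z w'.
pose h t := f (set_coord i x t); pose h' t := partial i f (set_coord i x t).
have line t : set_coord i x t = t *: delta_mx 0 i + set_coord i x 0.
  apply/rowP => j; rewrite !mxE /=; case: eqVneq => _; first by rewrite mulr1 addr0.
  by rewrite mulr0 add0r.
have dh (t : R) : is_derive t 1 h (h' t).
  rewrite /h /h' line.
  rewrite (_ : (fun s => _) = (fun s => f (s *: delta_mx 0 i + set_coord i x 0))).
    by apply: is_derive_line; exact: (fC i).1.
  by apply/funext => s; rewrite line.
have ch' : continuous h'.
  move=> t; rewrite /h'; apply: (cvg_comp _ (partial i f)) (cdf _).
  apply/cvg_ballP => e e0.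
  apply: (@filterS _ (nbhs t) _ (ball t e)) (nbhsx_ballx t e e0) => s ts.
  by split => // a j; rewrite ord1 !mxE; case: eqP => _; [|exact: ballxx].
have ch : continuous h.
  by move=> t; apply/differentiable_continuous/derivable1_diffP; case: (dh t).
rewrite (Rintegral_normal_coord i (f := fun t => t * h t)); last first.
  by apply: measurable_funM => //; exact: continuous_measurable_fun.
rewrite (Rintegral_normal_coord i (f := h')); last exact: continuous_measurable_fun.
by apply: (stein_identity (M := M)) => // t; [exact: fM|exact: dfM].
Qed.

End gaussian_vector.

(** * Gaussian smoothing *)

Lemma continuous_translation_scale (R : realType) (V : normedModType R) (b : R) (a : V) :
  continuous (fun z : V => a + b *: z).
Proof. by move=> z; apply: cvgD; [exact: cvg_cst|apply: cvgZr; exact: cvg_id]. Qed.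

Lemma is_derive_affine (R : realType) (a c t : R) : is_derive t 1 (fun s => s * a + c) a.
Proof.
have := is_deriveD (is_derive_mulr_cst a t) (is_derive_cst c t (1 : R)).
by rewrite addr0.
Qed.

Section smoothing.
Context (d : measure_display) (T : measurableType d) (R : realType)
  (P : probability T R) (k : nat) (Z : 'I_k -> {RV P >-> R}).
Hypothesis Znormal : standard_normal P Z.

(** The Gaussian regularization of [f] at scale [b], when [Z] is standard normal. *)
Definition smooth (b : R) (f : 'rV[R]_k -> R) (x : 'rV[R]_k) : R :=
  \int[P]_w f (x + b *: random_vector Z w).

Let mZ i : measurable_fun setT (Z i). Proof. exact: measurable_funPT. Qed.

Lemma measurable_smoothand (b : R) (f : 'rV[R]_k -> R) (x : 'rV[R]_k) : continuous f ->
  measurable_fun setT (fun w => f (x + b *: random_vector Z w)).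
Proof.
move=> cf; rewrite (_ : (fun w => _) = (fun w => f (\row_i (x 0 i + b * Z i w)))).
  apply: (@measurable_fun_row R _ _ k f (fun i w => x 0 i + b * Z i w) cf) => i.
  by apply: measurable_funD => //; exact: measurable_funM.
by apply/funext => w; congr f; apply/rowP => i; rewrite !mxE.
Qed.

Lemma smooth_bounded (b : R) (f : 'rV[R]_k -> R) (M : R) : continuous f ->
  (forall x, `|f x| <= M) -> forall x, `|smooth b f x| <= M.
Proof.
move=> cf fM x.
exact: (normr_Rintegral_bounded P (measurable_smoothand b x cf) (fun w => fM _)).
Qed.

Let integrable_smoothand (b : R) (f : 'rV[R]_k -> R) (M : R) (x : 'rV[R]_k) : continuous f ->
  (forall x, `|f x| <= M) ->
  P.-integrable setT (EFin \o (fun w => f (x + b *: random_vector Z w))).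
Proof.
move=> cf fM.
exact: (integrable_bounded P (measurable_smoothand b x cf) (fun w => fM _)).
Qed.

Lemma smooth_lipschitz (b : R) (f : 'rV[R]_k -> R) (M L : R) : continuous f ->
  (forall x, `|f x| <= M) -> (forall x y, `|f x - f y| <= L * l1norm (x - y)) ->
  forall x y, `|smooth b f x - smooth b f y| <= L * l1norm (x - y).
Proof.
move=> cf fM fL x y; rewrite /smooth -RintegralB//; [|exact: integrable_smoothand cf fM..].
apply: (@normr_Rintegral_bounded _ _ _ P (fun w => f (x + b *: random_vector Z w) -
    f (y + b *: random_vector Z w))) => [|w].
  by apply: measurable_funB; exact: measurable_smoothand.
by apply: le_trans (fL _ _) _; rewrite opprD addrACA subrr addr0.
Qed.

Lemma is_derive_translate (b : R) (f : 'rV[R]_k -> R) (x y : 'rV[R]_k) i : C1 f ->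
  is_derive y (delta_mx 0 i) (fun z : 'rV[R]_k => f (x + b *: z)) (b * partial i f (x + b *: y)).
Proof.
move=> fC; apply: is_derive_of_line.
pose c (h : R) := x + b *: (h *: delta_mx 0 i + y) : 'rV[R]_k.
pose c' : 'rV[R]_k := b *: delta_mx 0 i.
have dc j : is_derive (0 : R) 1 (fun s => c s 0 j) (c' 0 j).
  have -> : (fun s : R => c s 0 j) =
      (fun s => s * c' 0 j + (x + b *: y) 0 j).
    by apply/funext => s; rewrite /c' !mxE /=; ring.
  exact: is_derive_affine.
have := is_derive_curve fC dc; rewrite /c scale0r add0r (bigD1 i)//= big1 ?addr0.
  by rewrite /c' !mxE !eqxx /= mulr1; exact.
by move=> j ji; rewrite /c' !mxE (negbTE ji) mulr0 mul0r.
Qed.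

Let partial_translate (b : R) (f : 'rV[R]_k -> R) (x : 'rV[R]_k) : C1 f -> forall i y,
    partial i (fun z : 'rV[R]_k => f (x + b *: z)) y = b * partial i f (x + b *: y).
Proof. by move=> fC i y; case: (@is_derive_translate b f x y i fC). Qed.

Let continuous_translate (b : R) (f : 'rV[R]_k -> R) (x : 'rV[R]_k) : continuous f ->
  continuous (fun z : 'rV[R]_k => f (x + b *: z)).
Proof.
move=> cf y; apply: (cvg_comp (fun z : 'rV[R]_k => x + b *: z : 'rV[R]_k) f) (cf _).
exact: (continuous_translation_scale (x := y)).
Qed.

Let C1_translate (b : R) (f : 'rV[R]_k -> R) (x : 'rV[R]_k) : C1 f -> C1 (fun z : 'rV[R]_k => f (x + b *: z)).
Proof.
move=> fC i; split; first by move=> y; case: (@is_derive_translate b f x y i fC).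
rewrite (_ : partial i _ = fun y : 'rV[R]_k => b * partial i f (x + b *: y)).
  apply: (@continuous_mul R 'rV[R]_k (cst b)); first exact: cst_continuous.
  exact: (continuous_translate (fC i).2).
by apply/funext => y; exact: partial_translate.
Qed.

Lemma smooth_ibp (b : R) (f : 'rV[R]_k -> R) (M : R) i (x : 'rV[R]_k) : C1 f -> continuous f ->
  (forall x, `|f x| <= M) -> (forall x, `|partial i f x| <= M) ->
  \int[P]_w (Z i w * f (x + b *: random_vector Z w)) = b * smooth b (partial i f) x.
Proof.
move=> fC cf fM dfM; have M0 : 0 <= M by apply: le_trans (fM 0).
rewrite (gaussian_ibp (f := fun z : 'rV[R]_k => f (x + b *: z)) (M := (1 + `|b|) * M) Znormal).
- under eq_Rintegral do rewrite partial_translate//.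
  rewrite RintegralZl//; exact: integrable_smoothand (fC i).2 dfM.
- exact: C1_translate.
- exact: continuous_translate.
- by move=> z; apply: le_trans (fM _) _; rewrite mulrDl mul1r lerDl mulr_ge0.
- move=> z; rewrite partial_translate// normrM mulrDl mul1r.
  by rewrite ler_wpDl// ler_wpM2l.
Qed.

(** Integration by parts moves a derivative from the function to the Gaussian weight:
    the smoothed second derivatives of a function inherit a Lipschitz constant from its
    first derivatives. *)
Lemma smooth_partial_lipschitz (b : R) (f : 'rV[R]_k -> R) (M L : R) i : 0 < b ->
  C1 f -> continuous f ->
  (forall x, `|f x| <= M) -> (forall x, `|partial i f x| <= M) ->
  (forall x y, `|f x - f y| <= L * l1norm (x - y)) ->
  forall x y, `|smooth b (partial i f) x - smooth b (partial i f) y|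
    <= L / b * l1norm (x - y).
Proof.
move=> b0 fC cf fM dfM fL x y; rewrite mulrAC ler_pdivlMr//.
rewrite -[X in _ * X](gtr0_norm b0) -normrM mulrC mulrBr.
have ibp z := smooth_ibp b z fC cf fM dfM.
rewrite -[X in `|X - _|](ibp x) -[X in `|_ - X|](ibp y).
have iZ := integrable_normal_coord Znormal i.
have mf z : measurable_fun setT (fun w => Z i w * f (z + b *: random_vector Z w)).
  by apply: measurable_funM => //; exact: measurable_smoothand.
have iZf z : P.-integrable setT (EFin \o (fun w => Z i w * f (z + b *: random_vector Z w))).
  apply: (integrable_dominated (h := fun w => `|Z i w| * M)) => // [|w].
    by have := integrableZr measurableT M (integrable_abse iZ).
  by rewrite normrM ler_wpM2l.
rewrite -RintegralB//.
apply: (@le_trans _ _ (\int[P]_w (L * l1norm (x - y) * `|Z i w|))).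
  apply: normr_Rintegral_le => [||w]; first exact: measurable_funB.
    by have := integrableZl measurableT (L * l1norm (x - y)) (integrable_abse iZ).
  rewrite -mulrBr normrM mulrC ler_wpM2r//; apply: le_trans (fL _ _) _.
  by rewrite opprD addrACA subrr addr0.
rewrite RintegralZl//; last exact: (integrable_abse iZ).
rewrite ler_piMr//; last exact: normal_coord_abs_le1.
exact: le_trans (fL x y).
Qed.

End smoothing.

Lemma is_derive_Rintegral (d : measure_display) (T : measurableType d) (R : realType)
    (mu : {measure set T -> \bar R}) (f f' : R -> T -> R) (G : T -> R) (t : R) :
  (forall s, mu.-integrable setT (EFin \o f s)) ->
  (forall (s : R) w, is_derive s 1 (f ^~ w) (f' s w)) ->
  mu.-integrable setT (EFin \o G) -> (forall s w, `|f' s w| <= G w) ->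
  is_derive t 1 (fun s => \int[mu]_w f s w) (\int[mu]_w f' t w).
Proof.
move=> fi fd Gi fG.
have tI : `]t - 1, t + 1[%classic t by rewrite /= in_itv/= ltrBlDr !ltrDl ltr01.
have d1 s w : partial1of2 f s w = f' s w by rewrite partial1of2E; case: (fd s w).
have G0 w : 0 <= G w by apply: le_trans (fG t w).
have fd' s w : `]t - 1, t + 1[%classic s -> setT w -> derivable (f ^~ w) s 1.
  by case: (fd s w).
have fG' s w : `]t - 1, t + 1[%classic s -> setT w -> `|partial1of2 f s w| <= G w.
  by rewrite d1.
have fi' s : `]t - 1, t + 1[%classic s -> mu.-integrable setT (EFin \o f s) by [].
split; first exact: (derivable_under_integral measurableT tI fi' fd' G0 Gi fG').
rewrite -derive1E (differentiation_under_integral measurableT tI fi' fd' G0 Gi fG').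
by apply: eq_Rintegral => w _; exact: d1.
Qed.

Section smoothing_taylor.
Context (d : measure_display) (T : measurableType d) (R : realType)
  (P : probability T R) (k : nat) (Z : 'I_k -> {RV P >-> R}).
Hypothesis Znormal : standard_normal P Z.
Context (b : R) (f : 'rV[R]_k -> R) (M : R).
Hypotheses (fC : C1 f) (cf : continuous f) (fM : forall x, `|f x| <= M)
  (dfM : forall i x, `|partial i f x| <= M).

Lemma is_derive_smooth_line (x v : 'rV[R]_k) (t : R) :
  is_derive t 1 (fun s : R => smooth Z b f (x + s *: v))
    (\sum_i v 0 i * smooth Z b (partial i f) (x + t *: v)).
Proof.
have idf (i : 'I_k) y : P.-integrable setT
    (EFin \o (fun w => partial i f (y + b *: random_vector Z w))).
  exact: (integrable_bounded P (measurable_smoothand Z b y (fC i).2) (fun w => dfM i _)).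
have -> : \sum_i v 0 i * smooth Z b (partial i f) (x + t *: v) =
    \int[P]_w (\sum_i v 0 i * partial i f (x + t *: v + b *: random_vector Z w)).
  rewrite Rintegral_sum_ord => [|i]; last exact: (integrableZl measurableT (v 0 i) (idf i _)).
  by apply: eq_bigr => i _; rewrite /smooth -RintegralZl//; exact: idf.
apply: (@is_derive_Rintegral _ T R P (fun s w => f (x + s *: v + b *: random_vector Z w))
  (fun s w => \sum_i v 0 i * partial i f (x + s *: v + b *: random_vector Z w))
  (cst (\sum_i `|v 0 i| * M))).
- move=> s; exact: (integrable_bounded P (measurable_smoothand Z b _ cf) (fun w => fM _)).
- move=> s w; pose c (r : R) : 'rV[R]_k := x + r *: v + b *: random_vector Z w.
  apply: (is_derive_curve (c := c) fC) => i.
  have -> : (fun r : R => c r 0 i) =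
      (fun r => r * v 0 i + (x + b *: random_vector Z w) 0 i).
    by apply/funext => r; rewrite /c !mxE; ring.
  exact: is_derive_affine.
- exact: finite_measure_integrable_cst.
- move=> s w; apply: le_trans (ler_norm_sum _ _ _) _; apply: ler_sum => i _.
  by rewrite normrM ler_wpM2l.
Qed.

(** Along the segment from [x] to [x + v], the derivative of the remainder is controlled
    by [smooth_partial_lipschitz]; this gives a quadratic remainder even though [f]
    itself is only assumed once differentiable. *)
Lemma smooth_taylor (L : R) : 0 < b ->
  (forall x y, `|f x - f y| <= L * l1norm (x - y)) ->
  forall x v, `|smooth Z b f (x + v) - smooth Z b f x
      - \sum_i v 0 i * smooth Z b (partial i f) x| <= L / b / 2 * l1norm v ^+ 2.
Proof.
move=> b0 fL x v; set D := \sum_i _.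
pose p (t : R) := smooth Z b f (x + t *: v) - t * D.
have pd (t : R) : is_derive t 1 p
    (\sum_i v 0 i * smooth Z b (partial i f) (x + t *: v) - D).
  by apply: is_deriveB; [exact: is_derive_smooth_line|exact: is_derive_mulr_cst].
pose C := L / b * l1norm v ^+ 2.
pose q (t : R) := t ^+ 2 * (C / 2).
have qd (t : R) : is_derive t 1 q (t * C).
  have := is_deriveM (is_deriveX 2 (is_derive_id t (1 : R))) (is_derive_cst (C / 2) t (1 : R)).
  move=> dq; apply: is_derive_eq dq _.
  by rewrite /= scaler0 add0r expr1 -![_ *: _]/(_ * _); field.
have := increment_le ler01 pd qd.
rewrite /p /q !scale1r !scale0r addr0 !mul0r subr0 expr1n mul1r expr0n mul0r subr0.
rewrite mul1r addrAC => H; apply: le_trans (H _) _; last by rewrite /C mulrAC.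
move=> t; rewrite in_itv/= => /andP[t0 _]; rewrite /D -sumrB.
apply: le_trans (ler_norm_sum _ _ _) _.
rewrite /C expr2 mulrA {1}/l1norm mulr_sumr mulr_sumr.
apply: ler_sum => i _; rewrite -mulrBr normrM.
apply: le_trans (ler_wpM2l _ (smooth_partial_lipschitz Znormal (i := i) b0 fC cf fM (dfM i) fL _ _)) _ => //.
rewrite addrAC subrr add0r l1normZ (gtr0_norm t0) -/(l1norm v).
by rewrite le_eqVlt; apply/orP; left; apply/eqP; ring.
Qed.
End smoothing_taylor.

(** * Leave-one-out expansion *)

Lemma continuous_row (R : realType) (T : topologicalType) (k : nat) (c : 'I_k -> T -> R) :
  (forall i, continuous (c i)) -> continuous (fun x => \row_i c i x : 'rV[R]_k).
Proof.
move=> cc x; apply/cvg_ballP => e e0.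
have : \forall y \near x, forall i, ball (c i x) e (c i y).
  apply: near_ord => i; have /cvg_ballP/(_ e e0) := cc i x; exact.
by apply: filterS => y xy; split => // a i; rewrite !mxE; exact: xy.
Qed.

Lemma continuous_sum_ord (R : realType) (T : topologicalType) (n : nat) (c : 'I_n -> T -> R)
    (Q : pred 'I_n) :
  (forall i, continuous (c i)) -> continuous (fun x => \sum_(i < n | Q i) c i x).
Proof.
move=> cc x; apply: cvg_big => [|i _]; first exact: add_continuous.
exact: cc.
Qed.

Section centred_unit_variance.
Context (d : measure_display) (T : measurableType d) (R : realType)
  (P : probability T R) (Y : {RV P >-> R}).
Hypotheses (Ymean : ('E_P[Y] = 0)%E) (Yvar : ('E_P[(fun w => Y w ^+ 2)%R] = 1)%E).

Let mY : measurable_fun setT Y. Proof. exact: measurable_funPT. Qed.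

Lemma integrable_sq : P.-integrable setT (EFin \o (fun w => Y w ^+ 2)).
Proof.
apply/integrableP; split; first by apply/measurable_EFinP; exact: measurable_funX.
under eq_integral do rewrite /= ger0_norm ?sqr_ge0//.
by move: Yvar; rewrite unlock => ->; exact: ltry.
Qed.

Lemma Rintegral_sq : \int[P]_w (Y w ^+ 2) = 1.
Proof. by move: Yvar; rewrite unlock /Rintegral => ->. Qed.

Let integrable_half : P.-integrable setT (EFin \o (fun w => 2^-1 * (1 + Y w ^+ 2))).
Proof.
apply: (integrableZl measurableT 2^-1 (f := EFin \o (fun w => 1 + Y w ^+ 2))).
exact: (integrableD measurableT (finite_measure_integrable_cst P 1 measurableT) integrable_sq).
Qed.

Let abs_le_half w : `|Y w| <= 2^-1 * (1 + Y w ^+ 2).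
Proof.
rewrite -[Y w ^+ 2]real_normK ?num_real//; set y := `|Y w|.
by have := sqr_ge0 (y - 1); rewrite sqrrB1; lra.
Qed.

Lemma integrable_centred : P.-integrable setT (EFin \o Y).
Proof. exact: integrable_dominated mY integrable_half abs_le_half. Qed.

Lemma Rintegral_centred : \int[P]_w Y w = 0.
Proof. by move: Ymean; rewrite unlock /Rintegral => ->. Qed.

Lemma integrable_abs : P.-integrable setT (EFin \o (fun w => `|Y w|)).
Proof. by have := integrable_abse integrable_centred. Qed.

Lemma abs_moment1_le1 : \int[P]_w `|Y w| <= 1.
Proof.
apply: le_trans (le_Rintegral measurableT integrable_abs integrable_half _) _ => //.
rewrite (RintegralZl (f := fun w => 1 + Y w ^+ 2))//; last first.
  exact: (integrableD measurableT (finite_measure_integrable_cst P 1 measurableT) integrable_sq).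
rewrite RintegralD//; [|exact: finite_measure_integrable_cst|exact: integrable_sq].
by rewrite Rintegral_cst_probability Rintegral_sq; lra.
Qed.

(** From [2 y^2 <= |y|^3 + |y|], integrated. *)
Lemma abs_moment3_ge1 : P.-integrable setT (EFin \o (fun w => `|Y w| ^+ 3)) ->
  1 <= \int[P]_w (`|Y w| ^+ 3).
Proof.
move=> i3; have : \int[P]_w (2 * Y w ^+ 2) <= \int[P]_w (`|Y w| ^+ 3 + `|Y w|).
  apply: le_Rintegral => //; first exact: (integrableZl measurableT 2 integrable_sq).
    exact: (integrableD measurableT i3 integrable_abs).
  move=> w _; rewrite -[Y w ^+ 2]real_normK ?num_real//.
  have := normr_ge0 (Y w); set y := `|Y w| => y0.
  have -> : y ^+ 3 + y = 2 * y ^+ 2 + y * (y - 1) ^+ 2 by ring.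
  by rewrite lerDl mulr_ge0 ?sqr_ge0.
rewrite RintegralZl//; last exact: integrable_sq.
rewrite RintegralD//; last exact: integrable_abs.
by rewrite Rintegral_sq; have := abs_moment1_le1; lra.
Qed.
End centred_unit_variance.

(** After [fresh_copy], the factor [h] no longer depends on the inner variable. *)
Lemma Rintegral_indep_coord (d : measure_display) (T : measurableType d) (R : realType)
    (P : probability T R) (n : nat) (X : 'I_n -> {RV P >-> R}) (r : 'I_n)
    (phi : R -> R) (h : 'rV[R]_n -> R) (M : R) :
  mutually_independent P X -> continuous phi -> continuous h ->
  (forall x, `|h x| <= M) -> (forall x t, h (set_coord r x t) = h x) ->
  P.-integrable setT (EFin \o (fun w => phi (X r w))) ->
  P.-integrable setT (EFin \o (fun w => phi (X r w) * h (random_vector X w))) /\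
  \int[P]_w (phi (X r w) * h (random_vector X w)) =
  (\int[P]_w phi (X r w)) * \int[P]_w h (random_vector X w).
Proof.
move=> Xindep cphi ch hM hr iphi.
have mX i : measurable_fun setT (X i) by exact: measurable_funPT.
have mh : measurable_fun setT (fun w => h (random_vector X w)).
  exact: (measurable_fun_row ch mX).
have mphi : measurable_fun setT (fun w => phi (X r w)).
  exact: measurableT_comp (continuous_measurable_fun cphi) (mX r).
have dom : P.-integrable setT (EFin \o (fun w => `|phi (X r w)| * M)).
  by have := integrableZr measurableT M (integrable_abse iphi).
have iphih : P.-integrable setT (EFin \o (fun w => phi (X r w) * h (random_vector X w))).
  apply: (integrable_dominated _ dom) => [|w]; first exact: measurable_funM.
  by rewrite normrM ler_wpM2l.
split=> //.
have cphi' : continuous (fun x : 'rV[R]_n => phi (x 0 r)).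
  by move=> x; apply: (cvg_comp _ phi (@row_coord_continuous R n r x)) (cphi _).
have cf := continuous_mul cphi' ch.
have := @fresh_copy _ _ _ P n X r _ Xindep cf.
rewrite /= => E.
transitivity (\int[P]_w' \int[P]_w (phi (X r w) * h (random_vector X w'))).
  have -> : \int[P]_w (phi (X r w) * h (random_vector X w)) =
      \int[P]_w (phi (random_vector X w 0 r) * h (random_vector X w)).
    by apply: eq_Rintegral => w _; rewrite mxE.
  rewrite E.
  - apply: eq_Rintegral => w' _; apply: eq_Rintegral => w _.
    by rewrite mxE eqxx hr.
  - apply: eq_integrable iphih => // w _.
    by rewrite /= mxE.
  - move=> x; have := integrableZr measurableT (h x) iphi.
    by apply: eq_integrable => // w _; rewrite /= mxE eqxx hr.
rewrite -RintegralZl//; last exact: (integrable_bounded P mh (fun w => hM _)).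
by apply: eq_Rintegral => w' _; rewrite RintegralZr.
Qed.

Section leave_one_out.
Context (d : measure_display) (T : measurableType d) (R : realType)
  (P : probability T R) (n k : nat) (X : 'I_n -> {RV P >-> R}) (theta : 'I_k -> 'rV[R]_n).
Hypotheses (Xindep : mutually_independent P X) (Xmean : forall i, ('E_P[X i] = 0)%E)
  (Xvar : forall i, ('E_P[(fun w => X i w ^+ 2)%R] = 1)%E).

Let mX i : measurable_fun setT (X i). Proof. exact: measurable_funPT. Qed.

Lemma measurable_scaled_projections (a : R) (f : 'rV[R]_k -> R) : continuous f ->
  measurable_fun setT (fun w => f (a *: projections theta X w)).
Proof.
move=> cf; rewrite (_ : (fun w => _) =
    (fun w => f (\row_i (a * \sum_(s < n) theta i 0 s * X s w)))).
  apply: (@measurable_fun_row R _ _ k f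
    (fun i w => a * \sum_(s < n) theta i 0 s * X s w)) => // i.
  apply: measurable_funM => //; apply: measurable_sum => s.
  exact: measurable_funM.
apply/funext => w; congr f; apply/rowP => i; rewrite !mxE; congr (_ * _).
by apply: eq_bigr => s _; rewrite mxE.
Qed.

Definition projections_without (r : 'I_n) (a : R) (x : 'rV[R]_n) : 'rV[R]_k :=
  \row_i (a * \sum_(s < n | s != r) theta i 0 s * x 0 s).

Definition weights (r : 'I_n) : 'rV[R]_k := \row_i theta i 0 r.

Lemma scaled_projectionsE r a w : a *: projections theta X w =
  projections_without r a (random_vector X w) + (a * X r w) *: weights r.
Proof.
apply/rowP => i; rewrite !mxE /dotv (bigD1 r)//= !mxE mulrDr addrC.
by congr (_ + _); rewrite -mulrA [X in _ = _ * X]mulrC.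
Qed.

Lemma projections_without_continuous r a (f : 'rV[R]_k -> R) : continuous f ->
  continuous (fun x => f (projections_without r a x)).
Proof.
move=> cf x; apply: (cvg_comp (projections_without r a) f) (cf _).
apply: (@continuous_row R 'rV[R]_n k
  (fun i x => a * \sum_(s < n | s != r) theta i 0 s * x 0 s)) => i.
apply: (@continuous_mul R 'rV[R]_n (cst a)); first exact: cst_continuous.
apply: (@continuous_sum_ord R 'rV[R]_n n (fun s x => theta i 0 s * x 0 s)) => s.
apply: (@continuous_mul R 'rV[R]_n (cst (theta i 0 s))); first exact: cst_continuous.
exact: (@row_coord_continuous R n s).
Qed.

Lemma projections_without_set_coord r a x t :
  projections_without r a (set_coord r x t) = projections_without r a x.
Proof.
apply/rowP => i; rewrite !mxE; congr (_ * _); apply: eq_bigr => s sr.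
by rewrite mxE (negbTE sr).
Qed.

(** The summand [X r] enters the argument of [G] with weight [a]. Expanding [G] around
    the sum of the other terms, which is independent of [X r], the zeroth order vanishes
    because [X r] is centred, and the first order has coefficient one because [X r] has
    unit variance. *)
Lemma leave_one_out (G : 'rV[R]_k -> R) (H : 'I_k -> 'rV[R]_k -> R) (M L a m : R) r :
  continuous G -> (forall x, `|G x| <= M) ->
  (forall i, continuous (H i)) -> (forall i x, `|H i x| <= M) ->
  (forall i x y, `|H i x - H i y| <= L * l1norm (x - y)) ->
  (forall x v, `|G (x + v) - G x - \sum_i v 0 i * H i x| <= L / 2 * l1norm v ^+ 2) ->
  0 <= a -> 0 <= L ->
  P.-integrable setT (EFin \o (fun w => `|X r w| ^+ 3)) ->
  \int[P]_w (`|X r w| ^+ 3) <= m ->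
  `|\int[P]_w (X r w * G (a *: projections theta X w)) -
    a * \sum_i weights r 0 i * \int[P]_w H i (a *: projections theta X w)|
  <= 3 / 2 * L * a ^+ 2 * m * l1norm (weights r) ^+ 2.
Proof.
move=> cG GM cH HM HL taylor a0 L0 i3 m3.
set u := weights r; pose S w := a *: projections theta X w.
pose A w := projections_without r a (random_vector X w).
have iX := integrable_centred (Xvar r); have iX2 := integrable_sq (Xvar r).
have SE w : S w = A w + (a * X r w) *: u by exact: scaled_projectionsE.
have mA f : continuous f -> measurable_fun setT (fun w => f (A w) : R).
  by move=> cf; exact: (measurable_fun_row (projections_without_continuous (r := r) (a := a) cf) mX).
have mS f : continuous f -> measurable_fun setT (fun w => f (S w) : R).
  exact: measurable_scaled_projections.
have indep1 : P.-integrable setT (EFin \o (fun w => X r w * G (A w))) /\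
    \int[P]_w (X r w * G (A w)) = 0.
  have [i1 ->] := @Rintegral_indep_coord _ _ _ P n X r id _ M Xindep
    (fun t => cvg_id) (projections_without_continuous (r := r) (a := a) cG) (fun x => GM _)
    (fun x t => congr1 G (projections_without_set_coord r a x t)) iX.
  by split=> //; rewrite (Rintegral_centred (Xmean r)) mul0r.
have indep2 i : P.-integrable setT (EFin \o (fun w => X r w ^+ 2 * H i (A w))) /\
    \int[P]_w (X r w ^+ 2 * H i (A w)) = \int[P]_w H i (A w).
  have [i1 ->] := @Rintegral_indep_coord _ _ _ P n X r (fun t => t ^+ 2) _ M Xindep
    (@exprn_continuous _ 2) (projections_without_continuous (r := r) (a := a) (cH i)) (fun x => HM i _)
    (fun x t => congr1 (H i) (projections_without_set_coord r a x t)) iX2.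
  by split=> //; rewrite (Rintegral_sq (Xvar r)) mul1r.
pose B i w := a * u 0 i * (X r w ^+ 2 * H i (A w)).
have iB i : P.-integrable setT (EFin \o B i).
  exact: (integrableZl measurableT (a * u 0 i) (indep2 i).1).
pose rem w := X r w * (G (S w) - G (A w) - \sum_i ((a * X r w) *: u) 0 i * H i (A w)).
have decomp w : X r w * G (S w) = rem w + (X r w * G (A w) + \sum_i B i w).
  have -> : \sum_i B i w = X r w * \sum_i ((a * X r w) *: u) 0 i * H i (A w).
    by rewrite mulr_sumr; apply: eq_bigr => i _; rewrite /B !mxE; ring.
  by rewrite /rem; ring.
pose c := L / 2 * (a * l1norm u) ^+ 2.
have i3c : P.-integrable setT (EFin \o (fun w => c * `|X r w| ^+ 3)).
  exact: (integrableZl measurableT c i3).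
have remc w : `|rem w| <= c * `|X r w| ^+ 3.
  rewrite /rem normrM SE; apply: le_trans (ler_wpM2l _ (taylor _ _)) _ => //.
  rewrite l1normZ normrM (ger0_norm a0) le_eqVlt; apply/orP; left; apply/eqP.
  by rewrite /c; ring.
have mrem : measurable_fun setT rem.
  apply: measurable_funM => //; apply: measurable_funB.
    by apply: measurable_funB; [exact: mS|exact: mA].
  apply: measurable_sum => i; apply: measurable_funM; last exact: mA.
  rewrite (_ : (fun w => _) = (fun w => a * X r w * u 0 i)).
    by apply: measurable_funM => //; exact: measurable_funM.
  by apply/funext => w; rewrite mxE.
have irem := integrable_dominated mrem i3c remc.
have iBs := integrable_sum_ord iB.
have -> : \int[P]_w (X r w * G (S w)) =
    \int[P]_w rem w + \sum_i a * u 0 i * \int[P]_w H i (A w).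
  under eq_Rintegral do rewrite decomp.
  rewrite RintegralD//; last exact: (integrableD measurableT indep1.1 iBs).
  rewrite RintegralD//; last exact: indep1.1.
  rewrite indep1.2 add0r Rintegral_sum_ord//; congr (_ + _); apply: eq_bigr => i _.
  by rewrite -(indep2 i).2 RintegralZl//; exact: (indep2 i).1.
have cm : `|\int[P]_w rem w| <= c * m.
  apply: le_trans (normr_Rintegral_le mrem i3c remc) _.
  rewrite RintegralZl// ler_wpM2l// /c mulr_ge0 ?divr_ge0 ?sqr_ge0//.
have m1 : 1 <= m by apply: le_trans (abs_moment3_ge1 (Xvar r) i3) m3.
have HA i : `|\int[P]_w H i (A w) - \int[P]_w H i (S w)| <= L * a * l1norm u.
  rewrite -RintegralB//; first last.
  - exact: (integrable_bounded P (mS _ (cH i)) (fun w => HM i _)).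
  - exact: (integrable_bounded P (mA _ (cH i)) (fun w => HM i _)).
  have iab := integrableZl measurableT (L * a * l1norm u) (integrable_abs (Xvar r)).
  apply: le_trans (normr_Rintegral_le _ iab _) _.
  - by apply: measurable_funB; [exact: mA|exact: mS].
  - move=> w; apply: le_trans (HL i _ _) _.
    rewrite SE opprD addNKr -scaleNr l1normZ normrN normrM (ger0_norm a0).
    by rewrite le_eqVlt; apply/orP; left; apply/eqP; ring.
  rewrite (RintegralZl (f := fun w => `|X r w|))//; last exact: (integrable_abs (Xvar r)).
  rewrite ler_piMr//; last exact: (abs_moment1_le1 (Xvar r)).
  by rewrite !mulr_ge0// l1norm_ge0.
rewrite -addrA mulr_sumr -sumrB.
apply: le_trans (ler_normD _ _) _.
apply: (@le_trans _ _ (c * m + \sum_i (a * `|u 0 i|) * (L * a * l1norm u))).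
  apply: lerD => //; apply: le_trans (ler_norm_sum _ _ _) _; apply: ler_sum => i _.
  rewrite mulrA -mulrBr normrM normrM (ger0_norm a0).
  by apply: ler_wpM2l => //; rewrite mulr_ge0.
rewrite -mulr_suml -mulr_sumr -/(l1norm u) /c.
have := l1norm_ge0 u; set l := l1norm u => l0.
have : 0 <= L * a ^+ 2 * l ^+ 2 * (m - 1).
  by rewrite !mulr_ge0 ?sqr_ge0// subr_ge0.
by lra.
Qed.
End leave_one_out.

(** * Product integrals and power sums *)

Section product_integrals.
Context (d1 d2 : measure_display) (T1 : measurableType d1) (T2 : measurableType d2)
  (R : realType) (P1 : probability T1 R) (P2 : probability T2 R).
Local Notation Q := (P1 \x P2)%E.

Lemma integrable_fst (h : T1 -> R) : P1.-integrable setT (EFin \o h) ->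
  Q.-integrable setT (EFin \o (fun z => h z.1)).
Proof.
move=> ih; have /integrableP[/measurable_EFinP mh hoo] := ih.
have mh1 : measurable_fun setT (fun z : T1 * T2 => h z.1).
  by apply: measurableT_comp mh _; exact: measurable_fst.
apply/integrable12ltyP; first exact/measurable_EFinP.
apply: le_lt_trans hoo; rewrite le_eqVlt; apply/orP; left; apply/eqP.
apply: eq_integral => x _; transitivity (\int[P2]_y cst `|(h x)%:E| y)%E => //.
rewrite integral_cst// [X in (_ * X)%E](_ : _ = 1%E) ?mule1//.
exact: probability_setT.
Qed.

Lemma integrable_snd (h : T2 -> R) : P2.-integrable setT (EFin \o h) ->
  Q.-integrable setT (EFin \o (fun z => h z.2)).
Proof.
move=> ih; have /integrableP[/measurable_EFinP mh hoo] := ih.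
have mh1 : measurable_fun setT (fun z : T1 * T2 => h z.2).
  by apply: measurableT_comp mh _; exact: measurable_snd.
apply/integrable12ltyP; first exact/measurable_EFinP.
rewrite (_ : (\int[P1]_x _)%E = (\int[P1]_x cst (\int[P2]_y `|(h y)%:E|) x)%E)//.
rewrite integral_cst// [X in (_ * X)%E](_ : _ = 1%E) ?mule1//.
exact: probability_setT.
Qed.

Lemma Rintegral_prod (f : T1 * T2 -> R) : Q.-integrable setT (EFin \o f) ->
  (forall x, P2.-integrable setT (EFin \o (fun y => f (x, y)))) ->
  \int[Q]_z f z = \int[P1]_x \int[P2]_y f (x, y).
Proof.
move=> fi fi2; rewrite /Rintegral -(integral12_prod_meas1 fi); congr fine.
by apply: eq_integral => x _; rewrite /fubini_F fineK//; exact: integrable_fin_num (fi2 x).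
Qed.
End product_integrals.

Lemma cube_sum_le (R : realType) (k : nat) (x : 'I_k -> R) : (forall i, 0 <= x i) ->
  (\sum_i x i) ^+ 3 <= k%:R ^+ 2 * \sum_i x i ^+ 3.
Proof.
move=> x0; case: k x x0 => [|k] x x0; first by rewrite !big_ord0 expr0n mulr0.
set S := \sum_i x i; have S0 : 0 <= S by exact: sumr_ge0.
have k0 : 0 < k.+1%:R :> R by [].
pose mu := S / k.+1%:R; have mu0 : 0 <= mu by rewrite divr_ge0.
(* the cube lies above its tangent at the mean *)
have tangent i : 3 * mu ^+ 2 * x i - 2 * mu ^+ 3 <= x i ^+ 3.
  rewrite -subr_ge0.
  have -> : x i ^+ 3 - (3 * mu ^+ 2 * x i - 2 * mu ^+ 3) = (x i - mu) ^+ 2 * (x i + 2 * mu).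
    by ring.
  by rewrite mulr_ge0 ?sqr_ge0// addr_ge0// mulr_ge0.
have : \sum_i (3 * mu ^+ 2 * x i - 2 * mu ^+ 3) <= \sum_i x i ^+ 3 by apply: ler_sum.
rewrite sumrB -mulr_sumr sumr_const card_ord -/S -[X in _ - X <= _]mulr_natl => h.
have := ler_wpM2l (sqr_ge0 k.+1%:R) h; apply: le_trans.
rewrite le_eqVlt; apply/orP; left; apply/eqP; rewrite /mu.
by move: k0; move: (k.+1%:R : R) => K K0; field; rewrite gt_eqF.
Qed.

Lemma lpnorm3_cube (R : realType) (n : nat) (u : 'rV[R]_n) :
  lpnorm 3 u ^+ 3 = \sum_(r < n) `|u 0 r| ^+ 3.
Proof.
have S0 : 0 <= \sum_(r < n) `|u 0 r| `^ 3 by apply: sumr_ge0 => r _; exact: powR_ge0.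
rewrite /lpnorm -powR_mulrn ?powR_ge0// -powRrM mulVf ?pnatr_eq0// powRr1//.
by apply: eq_bigr => r _; rewrite powR_mulrn.
Qed.

(** * The Gaussian interpolation *)

(** Purely algebraic: orthonormality turns the diagonal terms [h j j] into double sums
    over the coordinates [r], to be matched with the terms [e j r]. *)
Lemma orthonormal_cancellation (R : realType) (n k : nat) (theta : 'I_k -> 'rV[R]_n)
    (a b : R) (e : 'I_k -> 'I_n -> R) (h : 'I_k -> 'I_k -> R) : orthonormal_family theta ->
  \sum_j (b * \sum_r theta j 0 r * e j r - a * (b * h j j)) =
  b * \sum_r \sum_j theta j 0 r * (e j r - a * \sum_i weights theta r 0 i * h i j).
Proof.
move=> theta_orth; rewrite exchange_big/= mulr_sumr; apply: eq_bigr => j _.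
have <- : \sum_r theta j 0 r * \sum_i weights theta r 0 i * h i j = h j j.
  under eq_bigr do rewrite mulr_sumr.
  have orth i : \sum_r theta j 0 r * (weights theta r 0 i * h i j) = (j == i)%:R * h i j.
    by rewrite -theta_orth /dotv mulr_suml; apply: eq_bigr => r _; rewrite mxE mulrA.
  rewrite exchange_big/= (eq_bigr _ (fun i _ => orth i)) (bigD1 j)//= eqxx mul1r.
  by rewrite big1 ?addr0// => i ij; rewrite eq_sym (negbTE ij) mul0r.
rewrite mulrCA -mulrBr; congr (_ * _).
rewrite mulr_sumr -sumrB; apply: eq_bigr => r _.
by rewrite mulrBr; congr (_ - _); rewrite mulrCA.
Qed.

Section interpolation.
Context (R : realType) (n k : nat) (d : measure_display) (T : measurableType d)
  (P : probability T R) (X : 'I_n -> {RV P >-> R}) (theta : 'I_k -> 'rV[R]_n)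
  (d' : measure_display) (T' : measurableType d') (P' : probability T' R)
  (Z : 'I_k -> {RV P' >-> R}) (g : 'rV[R]_k -> R).
Hypotheses (Xindep : mutually_independent P X) (Xmean : forall i, ('E_P[X i] = 0)%E)
  (Xvar : forall i, ('E_P[(fun w => X i w ^+ 2)%R] = 1)%E)
  (theta_orth : orthonormal_family theta) (Znormal : standard_normal P' Z)
  (gC2c : C2c g).

Local Notation Q := (P \x P')%E.
Local Notation S := (projections theta X).
Local Notation N := (random_vector Z).
Local Notation B := (fine (hess_sup g)).
Local Notation u r := (weights theta r).

Let mX i : measurable_fun setT (X i). Proof. exact: measurable_funPT. Qed.
Let mZ i : measurable_fun setT (Z i). Proof. exact: measurable_funPT. Qed.

(** A rotation from the Gaussian vector at [s = 0] to the projections at [s = pi / 2]: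
    the covariance is the identity all along. *)
Definition interpolation (s : R) (z : T * T') : 'rV[R]_k :=
  sin s *: S z.1 + cos s *: N z.2.

Lemma projections_coord j w : S w 0 j = \sum_(r < n) theta j 0 r * X r w.
Proof. by rewrite mxE; apply: eq_bigr => r _; rewrite mxE. Qed.

Lemma integrable_projections j : P.-integrable setT (EFin \o (fun w => S w 0 j)).
Proof.
rewrite (_ : (fun w => _) = (fun w => \sum_(r < n) theta j 0 r * X r w)).
  apply: integrable_sum_ord => r.
  exact: (integrableZl measurableT _ (integrable_centred (Xvar r))).
by apply/funext => w; exact: projections_coord.
Qed.

Lemma measurable_interpolation s (f : 'rV[R]_k -> R) : continuous f ->
  measurable_fun setT (fun z => f (interpolation s z)).
Proof.
move=> cf; rewrite (_ : (fun z => _) = (fun z : T * T' => f (\row_i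
    (sin s * \sum_(r < n) theta i 0 r * X r z.1 + cos s * Z i z.2)))).
  apply: (@measurable_fun_row R _ (T * T')%type k f (fun i z =>
    sin s * \sum_(r < n) theta i 0 r * X r z.1 + cos s * Z i z.2) cf) => i.
  apply: measurable_funD; apply: measurable_funM => //.
    apply: measurable_sum => r; apply: measurable_funM => //.
    exact: measurableT_comp (mX r) measurable_fst.
  exact: measurableT_comp (mZ i) measurable_snd.
apply/funext => z; congr f; apply/rowP => i.
by rewrite mxE [in LHS]mxE projections_coord !mxE.
Qed.

Lemma integrable_interpolation s (f : 'rV[R]_k -> R) (M : R) : continuous f ->
  (forall x, `|f x| <= M) -> Q.-integrable setT (EFin \o (fun z => f (interpolation s z))).
Proof.
move=> cf fM.
exact: (integrable_dominated (measurable_interpolation s cf)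
  (integrable_fst P' (finite_measure_integrable_cst P M measurableT)) (fun z => fM _)).
Qed.

Let F s := \int[Q]_z g (interpolation s z).

Lemma is_derive_interpolation (s : R) : is_derive s 1 F
  (\int[Q]_z \sum_j (cos s * S z.1 0 j - sin s * N z.2 0 j) * partial j g (interpolation s z)).
Proof.
have [M M0 gM] := C2c_bounded gC2c; have [M' M'0 dgM] := C2c_partial_bounded gC2c.
have cg : continuous g by case: gC2c => -[].
have iS j : P.-integrable setT (EFin \o (fun w => `|S w 0 j|)).
  by have := integrable_abse (integrable_projections j).
have iN j : P'.-integrable setT (EFin \o (fun w => `|Z j w|)).
  by have := integrable_abse (integrable_normal_coord Znormal j).
pose G (z : T * T') := \sum_(j < k) ((`|S z.1 0 j| + `|Z j z.2|) * M').
apply: (@is_derive_Rintegral _ _ R Q (fun s z => g (interpolation s z))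
  (fun s z => \sum_j (cos s * S z.1 0 j - sin s * N z.2 0 j) * partial j g (interpolation s z)) G).
- by move=> t; exact: integrable_interpolation cg gM.
- move=> t z; pose c' : 'rV[R]_k := \row_j (cos t * S z.1 0 j - sin t * N z.2 0 j).
  rewrite (eq_bigr (fun j => c' 0 j * partial j g (interpolation t z))); last first.
    by move=> j _; rewrite [c' _ _]mxE.
  apply: (is_derive_curve (c := interpolation ^~ z) (C2c_C1 gC2c)) => j.
  rewrite (_ : (fun r : R => _) = (fun r => S z.1 0 j *: sin r + N z.2 0 j *: cos r)).
    have d1 := is_deriveZ (S z.1 0 j) (is_derive_sin t).
    have d2 := is_deriveZ (N z.2 0 j) (is_derive_cos t).
    apply: is_derive_eq (is_deriveD d1 d2) _.
    by rewrite [in RHS]mxE -![_ *: _]/(_ * _); ring.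
  by apply/funext => r; rewrite mxE [X in X + _]mxE [X in _ + X]mxE -![_ *: _]/(_ * _); ring.
- apply: integrable_sum_ord => j.
  apply: (integrableZr measurableT M' (f := EFin \o (fun z : T * T' => `|S z.1 0 j| + `|Z j z.2|))).
  apply: (integrableD measurableT (f := EFin \o (fun z : T * T' => `|S z.1 0 j|))
    (g := EFin \o (fun z : T * T' => `|Z j z.2|))).
    exact: (integrable_fst P' (h := fun w => `|S w 0 j|) (iS j)).
  exact: (integrable_snd P (h := fun w => `|Z j w|) (iN j)).
- move=> t z; apply: le_trans (ler_norm_sum _ _ _) _; apply: ler_sum => j _.
  rewrite normrM ler_pM//; apply: le_trans (ler_normB _ _) _.
  rewrite !normrM [N _ _ _]mxE; apply: lerD; rewrite ler_piMl//.
    by rewrite ler_norml cos_geN1 cos_le1.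
  by rewrite ler_norml sin_geN1 sin_le1.
Qed.

Let cdg j : continuous (partial j g).
Proof. by case: gC2c => -[_ /(_ j) [_]]. Qed.

Let cddg i j : continuous (partial i (partial j g)).
Proof. by case: gC2c => -[_ _ /(_ i j) [_]]. Qed.

Let B_ge0 : 0 <= B. Proof. exact: fine_ge0 (hess_sup_ge0 g). Qed.

Let common_bound : exists M, [/\ 0 <= M, forall j x, `|partial j g x| <= M &
  forall i j x, `|partial i (partial j g) x| <= M].
Proof.
have [M M0 dgM] := C2c_partial_bounded gC2c; exists (M + B); split.
- by rewrite addr_ge0.
- by move=> j x; apply: le_trans (dgM j x) _; rewrite lerDl.
- by move=> i j x; apply: le_trans (hess_bound gC2c i j x) _; rewrite lerDr.
Qed.

Let smooth_partial_continuous (b : R) j : continuous (smooth Z b (partial j g)).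
Proof.
have [M [M0 dgM _]] := common_bound.
apply: (@lipschitz_l1norm_continuous R k _ B) => x y.
exact: (smooth_lipschitz Z b (@cdg j) (dgM j) (partial_lipschitz gC2c j) x y).
Qed.

Let smooth_hess_lipschitz (b : R) i j : 0 < b -> forall x y,
  `|smooth Z b (partial i (partial j g)) x - smooth Z b (partial i (partial j g)) y|
    <= B / b * l1norm (x - y).
Proof.
move=> b0 x y; have [M [M0 dgM ddgM]] := common_bound.
exact: (smooth_partial_lipschitz Znormal b0 (@C2c_C1_partial _ _ _ gC2c j) (@cdg j)
  (dgM j) (ddgM i j) (partial_lipschitz gC2c j) x y).
Qed.

Let smooth_hess_continuous (b : R) i j : 0 < b ->
  continuous (smooth Z b (partial i (partial j g))).
Proof.
by move=> b0; exact: (lipschitz_l1norm_continuous (smooth_hess_lipschitz i j b0)).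
Qed.

Let G s j := smooth Z (cos s) (partial j g).
Let H s i j := smooth Z (cos s) (partial i (partial j g)).

(** In the terms with a projection, the Gaussian vector is integrated first and yields
    [G]; in those with a Gaussian coordinate, integration by parts yields [H]. *)
Lemma interpolation_derivativeE (s : R) : 0 < cos s ->
  \int[Q]_z \sum_j (cos s * S z.1 0 j - sin s * N z.2 0 j) * partial j g (interpolation s z)
  = \sum_j (cos s * \sum_r theta j 0 r * \int[P]_w (X r w * G s j (sin s *: S w))
             - sin s * (cos s * \int[P]_w H s j j (sin s *: S w))).
Proof.
move=> b0; have [M [M0 dgM ddgM]] := common_bound.
have mU j := measurable_interpolation s (@cdg j).
have iSg j : Q.-integrable setT (EFin \o (fun z => S z.1 0 j * partial j g (interpolation s z))).
  have iS : P.-integrable setT (EFin \o (fun w => `|S w 0 j| * M)).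
    by have := integrableZr measurableT M (integrable_abse (integrable_projections j)).
  apply: (integrable_dominated _ (integrable_fst P' (h := fun w => `|S w 0 j| * M) iS)) => [|z].
    apply: measurable_funM => //.
    have /measurable_EFinP mS := measurable_int P (integrable_projections j).
    exact: measurableT_comp mS measurable_fst.
  by rewrite normrM ler_wpM2l.
have iNg j : Q.-integrable setT (EFin \o (fun z => Z j z.2 * partial j g (interpolation s z))).
  have iN : P'.-integrable setT (EFin \o (fun w => `|Z j w| * M)).
    by have := integrableZr measurableT M (integrable_abse (integrable_normal_coord Znormal j)).
  apply: (integrable_dominated _ (integrable_snd P (h := fun w => `|Z j w| * M) iN)) => [|z].
    by apply: measurable_funM => //; exact: measurableT_comp (mZ j) measurable_snd.
  by rewrite normrM ler_wpM2l.
have term j z : (cos s * S z.1 0 j - sin s * N z.2 0 j) * partial j g (interpolation s z) =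
    cos s * (S z.1 0 j * partial j g (interpolation s z)) -
    sin s * (Z j z.2 * partial j g (interpolation s z)).
  by rewrite [N _ _ _]mxE; ring.
under eq_Rintegral do under eq_bigr do rewrite term.
have iSg' j := integrableZl measurableT (cos s) (iSg j).
have iNg' j := integrableZl measurableT (sin s) (iNg j).
rewrite Rintegral_sum_ord => [|j]; last exact: (integrableB measurableT (iSg' j) (iNg' j)).
apply: eq_bigr => j _; rewrite RintegralB//; [|exact: iSg'|exact: iNg'].
rewrite RintegralZl// RintegralZl//.
have mg w : measurable_fun setT (fun w' => partial j g (sin s *: S w + cos s *: N w')).
  exact: measurable_smoothand.
have ig w : P'.-integrable setT (EFin \o (fun w' => partial j g (sin s *: S w + cos s *: N w'))).
  exact: (integrable_bounded P' (mg w) (fun w' => dgM j _)).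
congr (_ * _ - _ * _).
- rewrite Rintegral_prod//; last by move=> w; exact: (integrableZl measurableT (S w 0 j) (ig w)).
  transitivity (\int[P]_w \sum_r theta j 0 r * (X r w * G s j (sin s *: S w))).
    apply: eq_Rintegral => w _; transitivity (S w 0 j * G s j (sin s *: S w)).
      exact: (@RintegralZl _ _ _ P' setT _ (S w 0 j) measurableT (ig w)).
    rewrite projections_coord mulr_suml; apply: eq_bigr => r _.
    by rewrite -mulrA.
  have iXG r : P.-integrable setT (EFin \o (fun w => X r w * G s j (sin s *: S w))).
    apply: (integrable_dominated (h := fun w => `|X r w| * M)) => [||w].
    - apply: measurable_funM => //; apply: measurable_scaled_projections.
      exact: smooth_partial_continuous.
    - by have := integrableZr measurableT M (integrable_abse (integrable_centred (Xvar r))).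
    - by rewrite normrM ler_wpM2l//; exact: (smooth_bounded Z _ (@cdg j) (dgM j)).
  rewrite Rintegral_sum_ord => [|r]; last exact: (integrableZl measurableT _ (iXG r)).
  by apply: eq_bigr => r _; rewrite RintegralZl//; exact: iXG.
- rewrite Rintegral_prod//; last first.
    move=> w; apply: (integrable_dominated (h := fun w' => `|Z j w'| * M)) => [||w'].
    - exact: measurable_funM (mZ j) (mg w).
    - by have := integrableZr measurableT M (integrable_abse (integrable_normal_coord Znormal j)).
    - by rewrite normrM ler_wpM2l.
  rewrite -RintegralZl//; last first.
    apply: (integrable_bounded P (M := M)).
    + apply: measurable_scaled_projections.
      exact: smooth_hess_continuous.
    + by move=> w; exact: (smooth_bounded Z _ (@cddg j j) (ddgM j j)).
  apply: eq_Rintegral => w _.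
  have E := smooth_ibp Znormal (cos s) (sin s *: S w) (@C2c_C1_partial _ _ _ gC2c j) (@cdg j)
    (dgM j) (ddgM j j).
  by rewrite /H -E; apply: eq_Rintegral => w' _.
Qed.

Context (m : R).
Hypotheses (i3 : forall r, P.-integrable setT (EFin \o (fun w => `|X r w| ^+ 3)))
  (m3 : forall r, \int[P]_w (`|X r w| ^+ 3) <= m).

Let W : R := \sum_(r < n) l1norm (u r) ^+ 3.

(** By orthonormality the Gaussian part of the derivative is the sum over [r] of the
    first-order terms of the leave-one-out expansion, so that only remainders are left. *)
Lemma interpolation_derivative_le (s : R) : 0 < sin s -> 0 < cos s ->
  `|\int[Q]_z \sum_j (cos s * S z.1 0 j - sin s * N z.2 0 j) * partial j g (interpolation s z)|
  <= 3 / 2 * B * m * W * sin s ^+ 2.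
Proof.
move=> a0 b0; rewrite interpolation_derivativeE//.
have [M [M0 dgM ddgM]] := common_bound.
pose h i j := \int[P]_w H s i j (sin s *: S w).
rewrite (orthonormal_cancellation (sin s) (cos s)
  (fun j r => \int[P]_w (X r w * G s j (sin s *: S w))) h theta_orth).
pose L := B / cos s.
have L0 : 0 <= L by rewrite divr_ge0// ltW.
have DL j r : `|\int[P]_w (X r w * G s j (sin s *: S w)) -
    sin s * \sum_i u r 0 i * h i j| <= 3 / 2 * L * sin s ^+ 2 * m * l1norm (u r) ^+ 2.
  apply: (@leave_one_out _ _ _ P n k X theta Xindep Xmean Xvar (G s j)
    (fun i => H s i j) M L (sin s) m r) => //.
  - exact: smooth_partial_continuous.
  - exact: (smooth_bounded Z _ (@cdg j) (dgM j)).
  - by move=> i; exact: smooth_hess_continuous.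
  - by move=> i; exact: (smooth_bounded Z _ (@cddg i j) (ddgM i j)).
  - by move=> i; exact: smooth_hess_lipschitz.
  - exact: (smooth_taylor Znormal (@C2c_C1_partial _ _ _ gC2c j) (@cdg j)
      (dgM j) (fun i => ddgM i j) b0 (partial_lipschitz gC2c j)).
  - exact: ltW.
rewrite normrM (gtr0_norm b0).
apply: (@le_trans _ _ (cos s * \sum_r l1norm (u r) * (3 / 2 * L * sin s ^+ 2 * m * l1norm (u r) ^+ 2))).
  rewrite ler_pM2l//; apply: le_trans (ler_norm_sum _ _ _) _; apply: ler_sum => r _.
  apply: le_trans (ler_norm_sum _ _ _) _; rewrite {1}/l1norm mulr_suml; apply: ler_sum => j _.
  by rewrite normrM mxE ler_wpM2l.
rewrite le_eqVlt; apply/orP; left; apply/eqP; rewrite mulr_sumr /W mulr_sumr mulr_suml.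
apply: eq_bigr => r _; rewrite /L; set l := l1norm _.
by field; rewrite gt_eqF.
Qed.

(** The bound on the derivative integrates to at most [5 / 6] times its constant
    [3 / 2 * B * m * W], because [sin^2 <= sin (1 + sin^2) / 2]. *)
Lemma interpolation_bound :
  `|\int[P]_w g (S w) - \int[P']_w g (N w)| <= 5 / 4 * B * m * W.
Proof.
have [M M0 gM] := C2c_bounded gC2c; have cg : continuous g by case: gC2c => -[].
have sect (s : R) w :
    P'.-integrable setT (EFin \o (fun w' => g (sin s *: S w + cos s *: N w'))).
  exact: (integrable_bounded P' (measurable_smoothand Z _ _ cg) (fun w' => gM _)).
have F1 : F (pi / 2) = \int[P]_w g (S w).
  rewrite /F Rintegral_prod; first last.
  - move=> w; exact: (sect (pi / 2) w).
  - exact: integrable_interpolation cg gM.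
  apply: eq_Rintegral => w _; rewrite -[RHS](Rintegral_cst_probability P').
  by apply: eq_Rintegral => w' _; rewrite /interpolation sin_pihalf cos_pihalf scale1r scale0r addr0.
have F0 : F 0 = \int[P']_w g (N w).
  rewrite /F Rintegral_prod; first last.
  - move=> w; exact: (sect 0 w).
  - exact: integrable_interpolation cg gM.
  rewrite -[RHS](Rintegral_cst_probability P); apply: eq_Rintegral => w _.
  by apply: eq_Rintegral => w' _; rewrite /interpolation sin0 cos0 scale1r scale0r add0r.
rewrite -F1 -F0.
pose K := 3 / 2 * B * m * W.
have W0 : 0 <= W by apply: sumr_ge0 => r _; rewrite exprn_ge0// l1norm_ge0.
have pihalf0 : 0 <= pi / 2 :> R by rewrite divr_ge0// pi_ge0.
(* an antiderivative of [K sin (1 + sin^2) / 2], which dominates [K sin^2] *)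
pose q (s : R) := (cos s ^+ 3 / 6 - cos s) * K.
have qd (s : R) : is_derive s 1 q ((sin s - cos s ^+ 2 * sin s / 2) * K).
  have d3 := is_deriveM (is_deriveX 3 (is_derive_cos s)) (is_derive_cst (6^-1 : R) s (1 : R)).
  have d4 := is_deriveM (is_deriveB d3 (is_derive_cos s)) (is_derive_cst K s (1 : R)).
  apply: is_derive_eq d4 _; rewrite /= -![_ *: _]/(_ * _) !fctE; lra.
have := increment_le pihalf0 is_derive_interpolation qd.
have -> : q (pi / 2) - q 0 = 5 / 4 * B * m * W.
  by rewrite /q cos_pihalf cos0 /K; field.
apply=> s; rewrite in_itv/= => /andP[s0 s1].
have a0 : 0 < sin s by apply: sin_gt0_pihalf; rewrite s0.
have b0 : 0 < cos s by apply: cos_gt0_pihalf; rewrite s1 (lt_trans _ s0)// oppr_lt0 divr_gt0// pi_gt0.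
have := interpolation_derivative_le a0 b0; rewrite -/K => h; apply: le_trans h _.
have K0 : 0 <= K.
  have := le_trans (normr_ge0 _) (interpolation_derivative_le a0 b0).
  by rewrite -/K pmulr_lge0// exprn_gt0.
rewrite mulrC ler_wpM2r// cos2sin2; set a := sin s in a0 *.
have -> : a - (1 - a ^+ 2) * a / 2 = a ^+ 2 + a * (1 - a) ^+ 2 / 2 by field.
by rewrite lerDl divr_ge0// mulr_ge0 ?sqr_ge0// ltW.
Qed.
End interpolation.

(** * The central limit bound *)

(** When the third moments are infinite and the second derivatives vanish, the second
    term of the bound is [0 * +oo = 0]; the two expectations agree in this case, because
    a bounded function of constant gradient is constant. *)
Lemma hess_sup_eq0_constant (R : realType) (k : nat) (g : 'rV[R]_k -> R) : C2c g ->
  hess_sup g = 0%E -> forall x y, g x = g y.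
Proof.
move=> gC2c h0 x y.
have [M M0 gM] := C2c_bounded gC2c; have gC := C2c_C1 gC2c.
have cst j z : partial j g z = partial j g 0.
  apply/eqP; rewrite -subr_eq0 -normr_le0.
  by have := partial_lipschitz gC2c j z 0; rewrite h0 mul0r.
have d0 j : partial j g 0 = 0.
  apply/eqP; apply: contraT => c0; set c := partial j g 0 in c0 *.
  pose f (t : R) := g (t *: delta_mx 0 j + 0).
  have fd (t : R) : is_derive t 1 f c.
    have := is_derive_line ((gC j).1 (t *: delta_mx 0 j + 0)).
    by rewrite -[X in is_derive _ _ _ X]/(partial j g (t *: delta_mx 0 j + 0)) cst.
  have pd (t : R) : is_derive t 1 (fun t => f t - t * c) 0.
    by have := is_deriveB (fd t) (is_derive_mulr_cst c t); rewrite subrr.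
  (* a nonzero slope would carry [g] beyond its bound at distance [t] *)
  pose t := (2 * M + 1) / c.
  have z0 (s : R) : `|s| <= `|t| -> `|(0 : R)| <= 0 by rewrite normr0.
  have := is_derive_increment pd z0.
  rewrite /= !mul0r normr_le0 subr_eq0 subr0 divfK// => /eqP E.
  have := gM (t *: delta_mx 0 j + 0); have := gM (0 *: delta_mx 0 j + 0).
  rewrite -/(f t) -/(f 0) -E !ler_norml => /andP[h1 h2] /andP[h3 h4].
  by exfalso; clear h0; lra.
have p0 j z : `|partial j g z| <= 0 by rewrite cst d0 normr0.
have := lipschitz_l1norm gC p0 x y.
by rewrite mul0r normr_le0 subr_eq0 => /eqP.
Qed.

Lemma sum_weights_cube_le (R : realType) (n k : nat) (theta : 'I_k -> 'rV[R]_n) :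
  \sum_(r < n) l1norm (weights theta r) ^+ 3 <=
  k%:R ^+ 2 * \sum_(i < k) lpnorm 3 (theta i) ^+ 3.
Proof.
under [in leRHS]eq_bigr do rewrite lpnorm3_cube.
rewrite exchange_big/= mulr_sumr; apply: ler_sum => r _.
rewrite /l1norm; under [in leLHS]eq_bigr do rewrite mxE.
exact: cube_sum_le.
Qed.

Lemma lpnorm_cube_ge0 (R : realType) (n : nat) (v : 'rV[R]_n) : 0 <= lpnorm 3 v ^+ 3.
Proof. by rewrite exprn_ge0// powR_ge0. Qed.

Lemma sum_lpnorm_cube_gt0 (R : realType) (n k : nat) (theta : 'I_k -> 'rV[R]_n) (i : 'I_k) :
  orthonormal_family theta -> 0 < \sum_(i < k) lpnorm 3 (theta i) ^+ 3.
Proof.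
move=> theta_orth; rewrite (bigD1 i)//= ltr_pwDl//; last first.
  by apply: sumr_ge0 => j _; exact: lpnorm_cube_ge0.
rewrite lt_neqAle lpnorm_cube_ge0 andbT eq_sym lpnorm3_cube.
apply: contra_eqN (theta_orth i i) => /eqP E0.
have th0 r : theta i 0 r = 0.
  have /eqP : `|theta i 0 r| ^+ 3 = 0 by apply: (psumr_eq0P _ E0) => // s _; exact: exprn_ge0.
  by rewrite expf_eq0/= normr_eq0 => /eqP.
by rewrite /dotv eqxx big1 ?(eq_sym 0) ?oner_eq0// => r _; rewrite th0 mul0r.
Qed.

Theorem theorem2 (R : realType) (n k : nat)
    (d : measure_display) (T : measurableType d) (P : probability T R)
    (X : 'I_n -> {RV P >-> R})
    (Xindep : mutually_independent P X)
    (Xmean : forall i, ('E_P[X i] = 0)%E)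
    (Xvar : forall i, ('E_P[(fun w => X i w ^+ 2)%R] = 1)%E)
    (theta : 'I_k -> 'rV[R]_n)
    (theta_orth : orthonormal_family theta)
    (d' : measure_display) (T' : measurableType d') (P' : probability T' R)
    (Z : 'I_k -> {RV P' >-> R})
    (Znormal : standard_normal P' Z)
    (g : 'rV[R]_k -> R)
    (gC2c : C2c g) :
  (`| 'E_P[(g \o projections theta X)%R] - 'E_P'[(g \o random_vector Z)%R] |
    <= (Num.sqrt k%:R / 2)%:E * grad_sup g * sqrte (max_moment4 P X - 1)
         * (\sum_(i < k) lpnorm 4 (theta i) ^+ 2)%R%:E
     + (4 / 3 * k%:R ^+ 2)%:E * hess_sup g * max_abs_moment3 P X
         * (\sum_(i < k) lpnorm 3 (theta i) ^+ 3)%R%:E)%E.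
Proof.
have [M M0 gM] := C2c_bounded gC2c; have cg : continuous g by case: gC2c => -[].
have mX i : measurable_fun setT (X i) by exact: measurable_funPT.
have mZ i : measurable_fun setT (Z i) by exact: measurable_funPT.
have iS : P.-integrable setT (EFin \o (fun w => g (projections theta X w))).
  apply: (integrable_bounded P (M := M)) => // .
  have := measurable_scaled_projections X theta 1 cg.
  by under eq_fun do rewrite scale1r.
have iZ : P'.-integrable setT (EFin \o (fun w => g (random_vector Z w))).
  by apply: (integrable_bounded P' (M := M)) => //; exact: (measurable_fun_row cg mZ).
have -> : ('E_P[(g \o projections theta X)%R] = (\int[P]_w g (projections theta X w))%R%:E)%E.
  by rewrite unlock /Rintegral fineK//; exact: integrable_fin_num iS.
have -> : ('E_P'[(g \o random_vector Z)%R] = (\int[P']_w g (random_vector Z w))%R%:E)%E.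
  by rewrite unlock /Rintegral fineK//; exact: integrable_fin_num iZ.
rewrite -EFinB abse_EFin.
set D := `| _ |; set first := (X in (_ <= X + _)%E).
have first_ge0 : (0 <= first)%E.
  apply: mule_ge0; last by rewrite lee_fin sumr_ge0// => i _; rewrite exprn_ge0// powR_ge0.
  apply: mule_ge0; last exact: sqrte_ge0.
  by apply: mule_ge0; [rewrite lee_fin divr_ge0// sqrtr_ge0|exact: grad_sup_ge0].
apply: (@le_trans _ _ ((4 / 3 * k%:R ^+ 2)%:E * hess_sup g * max_abs_moment3 P X
         * (\sum_(i < k) lpnorm 3 (theta i) ^+ 3)%R%:E)%E); last by rewrite leeDr.
set Sig := \sum_(i < k) _; have Sig0 : 0 <= Sig.
  by apply: sumr_ge0 => i _; exact: lpnorm_cube_ge0.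
rewrite -[hess_sup g]fineK ?hess_sup_fin_num//; set B := fine _.
have B0 : 0 <= B by apply: fine_ge0; exact: hess_sup_ge0.
have mom_ge0 : (0 <= max_abs_moment3 P X)%E by exact: bigmax_ge_id.
have mom r : ('E_P[(fun w => `|X r w| ^+ 3)%R] <= max_abs_moment3 P X)%E.
  exact: (le_bigmax _ (fun j => 'E_P[(fun w => `|X j w| ^+ 3)%R])%E r).
(* with infinite third moments, the second term is infinite unless [B] vanishes *)
have [moo|mfin] := eqVneq (max_abs_moment3 P X) +oo%E.
  have [B00|Bneq0] := eqVneq B 0.
    have h0 : hess_sup g = 0%E by rewrite -[hess_sup g]fineK ?hess_sup_fin_num// -/B B00.
    have gc := hess_sup_eq0_constant gC2c h0.
    rewrite B00 mule0 !mul0e /D lee_fin.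
    have -> : \int[P]_w g (projections theta X w) = g 0.
      by rewrite -[RHS](Rintegral_cst_probability P); apply: eq_Rintegral => w _; exact: gc.
    have -> : \int[P']_w g (random_vector Z w) = g 0.
      by rewrite -[RHS](Rintegral_cst_probability P'); apply: eq_Rintegral => w _; exact: gc.
    by rewrite subrr normr0.
  have k0 : (0 < k)%N.
    by rewrite lt0n; apply: contra_neqN Bneq0 => /eqP k0; rewrite /B; subst k; rewrite /hess_sup big_ord0.
  have Sig_gt0 : 0 < Sig by exact: (sum_lpnorm_cube_gt0 (Ordinal k0) theta_orth).
  rewrite moo -EFinM gt0_muley ?lte_fin; last first.
    by rewrite !mulr_gt0// ?exprn_gt0 ?ltr0n// lt_neqAle eq_sym Bneq0.
  by rewrite gt0_mulye ?lte_fin ?leey.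
have mfin' : max_abs_moment3 P X \is a fin_num by rewrite ge0_fin_numE// ltey.
rewrite -[max_abs_moment3 P X]fineK//; set m := fine _.
have mom' r : (\int[P]_w (`|X r w| ^+ 3)%:E <= m%:E)%E.
  by rewrite /m fineK//; have := mom r; rewrite unlock.
have i3 r : P.-integrable setT (EFin \o (fun w => `|X r w| ^+ 3)).
  apply/integrableP; split.
    by apply/measurable_EFinP; apply: measurable_funX; exact: measurableT_comp.
  under eq_integral do rewrite /= ger0_norm ?exprn_ge0//.
  by apply: le_lt_trans (mom' r) _; exact: ltry.
have m3 r : \int[P]_w (`|X r w| ^+ 3) <= m.
  by rewrite -lee_fin /Rintegral fineK//; exact: integrable_fin_num (i3 r).
have m0 : 0 <= m by apply: fine_ge0.
rewrite -!EFinM lee_fin.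
apply: le_trans (interpolation_bound Xindep Xmean Xvar theta_orth Znormal gC2c i3 m3) _.
rewrite -/B; apply: (@le_trans _ _ (5 / 4 * B * m * (k%:R ^+ 2 * Sig))).
  apply: ler_wpM2l; first by rewrite !mulr_ge0.
  exact: sum_weights_cube_le.
have : 0 <= B * m * (k%:R ^+ 2 * Sig) by rewrite !mulr_ge0// sqr_ge0.
by lra.
Qed.
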